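(* Assume (A2). For every $y\in\mathcal U$, $$E^{\rm ecc}(y)=\sum_{b\in\mathcal B,\ b\not\subset\Omega_c}\big(e_b(y)-c_b(y)\big)+E_c(y),$$ where $E^{\rm ecc}(y)=\sum_{b\in\mathcal B,\ b\not\subset\Omega_c}e_b(y)+\sum_{b\in\mathcal B,\ b\subset\Omega_c}c_b(y)$ and $E_c(y)=\sum_{T\in\mathcal T}\sum_{r\in\mathcal R}|T|\,\phi\big(D_r y|_T\big)$.
   Context: Two-dimensional setting. Let $\Omega\subset\mathbb R^2$ be open and bounded, $\Omega_a\subset\Omega$ open, $\Omega_c=\Omega\setminus\overline{\Omega_a}$ an open polygon with vertices in $\mathbb Z^2$, $\mathcal T$ a triangulation of $\overline{\Omega_c}$ by triangles with vertices in $\mathbb Z^2$, and $\mathcal P_1(\mathcal T)$ the continuous $\mathbb R^2$-valued functions on $\overline{\Omega_c}$ affine on each triangle. Let $\mathcal I=\Omega\cap\mathbb Z^2$, $\mathcal I_a=\Omega_a\cap\mathbb Z^2$, and $\mathcal R\subset\mathbb Z^2\setminus\{0\}$ finite. Assumption (A2): for every $r\in\mathcal R$ and every $i\in\mathbb Z^2$ with $(i,i+r)\cap\overline{\Omega_c}\neq\emptyset$, one has $i,i+r\in\mathcal I$. Let $\mathcal U=\{y:\mathcal I_a\cup\overline{\Omega_c}\to\mathbb R^2: y|_{\overline{\Omega_c}}\in\mathcal P_1(\mathcal T)\}$, $y_i=y(i)$. A bond $(x_1,x_2)$ is the open segment between $x_1,x_2$; $\mathcal B=\{(i,i+r): r\in\mathcal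 R,\ i,i+r\in\mathcal I\}$ (indexed by $(i,r)$). Bond average: $⨍_{(x_1,x_2)}f\,db=\int_0^1f((1-\lambda)x_1+\lambda x_2)d\lambda$. Directional derivative $D_ry(x)=\lim_{\varepsilon\to0}\frac{y(x+\varepsilon r)-y(x)}{\varepsilon}$; $D_r y|_T=(\nabla y|_T)\,r$ is the constant value on $T\in\mathcal T$. For a polygonal set $\omega$, $\chi_\omega(x)=\lim_{\rho\to0}|\omega\cap B_\rho(x)|/|B_\rho(x)|$ (so it is $1$ in the interior, $1/2$ on edges, $\alpha/2\pi$ at a vertex of angle $\alpha$, $0$ outside the closure). Let $\varphi:[0,\infty)\to\mathbb R$ be continuous and $\phi(z)=\varphi(|z|)$. Exact contribution $e_{(i,i+r)}(y)=\phi(y_{i+r}-y_i)$. Continuum contribution of any bond $b=(i,i+r)$: $c_b(y)=⨍_b\chi_{\Omega_c}\phi(D_ry)\,db$, where the integrand is taken to be $0$ wherever $\chi_{\Omega_c}=0$. *)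

(* Defs.v *)
From Stdlib Require Import Reals Lra ZArith List.
From Stdlib Require Import Classical ClassicalEpsilon.
Import ListNotations.
Open Scope R_scope.

Definition pt := (R * R)%type.
Definition zpt := (Z * Z)%type.
Definition inj (i : zpt) : pt := (IZR (fst i), IZR (snd i)).
Definition zadd (i j : zpt) : zpt := ((fst i + fst j)%Z, (snd i + snd j)%Z).
Definition zpt_eqb (i j : zpt) : bool := (Z.eqb (fst i) (fst j) && Z.eqb (snd i) (snd j))%bool.
Definition padd (x z : pt) : pt := (fst x + fst z, snd x + snd z).
Definition psub (x z : pt) : pt := (fst x - fst z, snd x - snd z).
Definition pscal (a : R) (x : pt) : pt := (a * fst x, a * snd x).
Definition pnorm (x : pt) : R := sqrt (fst x ^ 2 + snd x ^ 2).
Definition p_dist (x z : pt) : R := pnorm (psub x z).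
Definition seg_pt (x1 x2 : pt) (l : R) : pt := padd (pscal (1 - l) x1) (pscal l x2).

Definition p_is_open (S : pt -> Prop) : Prop :=
  forall x, S x -> exists d, 0 < d /\ forall z, p_dist z x < d -> S z.
Definition p_closure (S : pt -> Prop) (x : pt) : Prop :=
  forall e, 0 < e -> exists z, S z /\ p_dist z x < e.
Definition p_interior (S : pt -> Prop) (x : pt) : Prop :=
  exists d, 0 < d /\ forall z, p_dist z x < d -> S z.
Definition p_bounded (S : pt -> Prop) : Prop :=
  exists M, forall x, S x -> pnorm x <= M.
Definition cont_on (S : pt -> Prop) (y : pt -> pt) : Prop :=
  forall x, S x -> forall e, 0 < e -> exists d, 0 < d /\
    forall z, S z -> p_dist z x < d -> p_dist (y z) (y x) < e.

Definition tri := (zpt * zpt * zpt)%type.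
Definition tA (T : tri) : zpt := fst (fst T).
Definition tB (T : tri) : zpt := snd (fst T).
Definition tC (T : tri) : zpt := snd T.
Definition tri0 : tri := ((0%Z, 0%Z), (0%Z, 0%Z), (0%Z, 0%Z)).
Definition tri_det (T : tri) : R :=
  let a := inj (tA T) in let b := inj (tB T) in let c := inj (tC T) in
  (fst b - fst a) * (snd c - snd a) - (snd b - snd a) * (fst c - fst a).
Definition tri_area (T : tri) : R := Rabs (tri_det T) / 2.
Definition in_tri (T : tri) (x : pt) : Prop :=
  let a := inj (tA T) in let b := inj (tB T) in let c := inj (tC T) in
  exists s t, 0 <= s /\ 0 <= t /\ s + t <= 1 /\
    x = padd a (padd (pscal s (psub b a)) (pscal t (psub c a))).
Definition in_tri_open (T : tri) (x : pt) : Prop :=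
  let a := inj (tA T) in let b := inj (tB T) in let c := inj (tC T) in
  exists s t, 0 < s /\ 0 < t /\ s + t < 1 /\
    x = padd a (padd (pscal s (psub b a)) (pscal t (psub c a))).
Definition centroid (T : tri) : pt :=
  pscal (1/3) (padd (inj (tA T)) (padd (inj (tB T)) (inj (tC T)))).
Definition tri_verts (T : tri) : list zpt := [tA T; tB T; tC T].
Definition common_verts (T1 T2 : tri) : list zpt :=
  filter (fun v => existsb (zpt_eqb v) (tri_verts T2)) (tri_verts T1).
Fixpoint hull (l : list pt) (x : pt) : Prop :=
  match l with
  | nil => False
  | p :: l' =>
      match l' with
      | nil => x = p
      | _ => exists t z, 0 <= t <= 1 /\ hull l' z /\
                         x = padd (pscal (1 - t) p) (pscal t z)
      end
  end.

(* a (conforming) triangulation: nondegenerate triangles with pairwise disjoint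
   interiors, two distinct triangles meeting exactly in the convex hull of
   their common vertices (empty, a common vertex, or a common edge) *)
Definition triangulation (LT : list tri) : Prop :=
  (forall T, In T LT -> tri_det T <> 0) /\
  (forall k l, (k < length LT)%nat -> (l < length LT)%nat -> k <> l ->
     forall x, ~ (in_tri_open (nth k LT tri0) x /\ in_tri_open (nth l LT tri0) x)) /\
  (forall k l, (k < length LT)%nat -> (l < length LT)%nat -> k <> l ->
     forall x, (in_tri (nth k LT tri0) x /\ in_tri (nth l LT tri0) x) <->
               hull (map inj (common_verts (nth k LT tri0) (nth l LT tri0))) x).

Definition unionT (LT : list tri) (x : pt) : Prop := exists T, In T LT /\ in_tri T x.

Definition affine_on (S : pt -> Prop) (y : pt -> pt) : Prop :=
  exists a11 a12 a21 a22 c1 c2 : R, forall x, S x ->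
    y x = (a11 * fst x + a12 * snd x + c1, a21 * fst x + a22 * snd x + c2).

Definition in_P1 (LT : list tri) (Ocl : pt -> Prop) (y : pt -> pt) : Prop :=
  cont_on Ocl y /\ forall T, In T LT -> affine_on (in_tri T) y.

(* Riemann integral over [a,b] when it exists (0 otherwise) *)
Definition RInt (f : R -> R) (a b : R) : R :=
  match excluded_middle_informative (inhabited (Riemann_integrable f a b)) with
  | left H => RiemannInt (epsilon H (fun _ => True))
  | right _ => 0
  end.
Definition indic (P : Prop) : R :=
  if excluded_middle_informative P then 1 else 0.
Definition area_box (S : pt -> Prop) (a b c d : R) : R :=
  RInt (fun s => RInt (fun t => indic (S (s, t))) c d) a b.
Definition density (S : pt -> Prop) (x : pt) (rho : R) : R :=
  area_box (fun z => S z /\ p_dist z x < rho)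
    (fst x - rho) (fst x + rho) (snd x - rho) (snd x + rho) / (PI * rho ^ 2).
Definition chi (S : pt -> Prop) (x : pt) : R :=
  epsilon (inhabits 0) (fun l => forall e, 0 < e -> exists d, 0 < d /\
    forall rho, 0 < rho < d -> Rabs (density S x rho - l) < e).
Definition Dr (y : pt -> pt) (r : pt) (x : pt) : pt :=
  epsilon (inhabits (0, 0)) (fun L => forall e, 0 < e -> exists d, 0 < d /\
    forall h, 0 < Rabs h < d ->
      pnorm (psub (pscal (/ h) (psub (y (padd x (pscal h r))) (y x))) L) < e).
Definition bond_avg (f : pt -> R) (x1 x2 : pt) : R :=
  RInt (fun l => f (seg_pt x1 x2 l)) 0 1.

Definition phi (varphi : R -> R) (z : pt) : R := varphi (pnorm z).
Definition Oc_of (Om Oa : pt -> Prop) (x : pt) : Prop := Om x /\ ~ p_closure Oa x.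

Definition e_b (varphi : R -> R) (y : pt -> pt) (i r : zpt) : R :=
  phi varphi (psub (y (inj (zadd i r))) (y (inj i))).
Definition c_b (Oc : pt -> Prop) (varphi : R -> R) (y : pt -> pt) (i r : zpt) : R :=
  bond_avg (fun z => if excluded_middle_informative (chi Oc z = 0) then 0
                     else chi Oc z * phi varphi (Dr y (inj r) z))
           (inj i) (inj (zadd i r)).
Definition bond_in (Oc : pt -> Prop) (i r : zpt) : Prop :=
  forall l, 0 < l < 1 -> Oc (seg_pt (inj i) (inj (zadd i r)) l).

Definition sum_list {A : Type} (f : A -> R) (l : list A) : R :=
  fold_right (fun a s => f a + s) 0 l.
(* sum over B = {(i,i+r) : r in R, i, i+r in I}, indexed by (i,r) *)
Definition bond_sum (LI LR : list zpt) (F : zpt -> zpt -> R) : R :=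
  sum_list (fun i => sum_list (fun r => indic (In (zadd i r) LI) * F i r) LR) LI.

Definition E_ecc (Oc : pt -> Prop) (LI LR : list zpt) (varphi : R -> R) (y : pt -> pt) : R :=
  bond_sum LI LR (fun i r =>
    indic (~ bond_in Oc i r) * e_b varphi y i r + indic (bond_in Oc i r) * c_b Oc varphi y i r).
(* D_r y|_T : the constant value of D_r y on T, evaluated at the centroid *)
Definition E_c (LT : list tri) (LR : list zpt) (varphi : R -> R) (y : pt -> pt) : R :=
  sum_list (fun T => sum_list (fun r =>
    tri_area T * phi varphi (Dr y (inj r) (centroid T))) LR) LT.

Definition cont_nonneg (varphi : R -> R) : Prop :=
  forall t, 0 <= t -> forall e, 0 < e -> exists d, 0 < d /\
    forall s, 0 <= s -> Rabs (s - t) < d -> Rabs (varphi s - varphi t) < e.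

(* Main.v *)
(* Let c_b be the continuum contribution of a bond.  The claim reduces to the
   statement that the sum of c_b over all bonds is E_c, and, triangle by triangle,
   to the bond density lemma: for a lattice triangle T and a nonzero r, the averages
   of the density of T over the bonds (i, i+r), i in Z^2, add up to |T|.
   Almost everywhere on a bond this density is, up to orientation, the winding number
   of the boundary of T, a sum of three antisymmetric edge terms, so it is additive
   under subdivision of signed triangles.  Summed over the lattice it is moreover
   invariant under lattice translations and point reflections; hence
   f(a, b) = total of the triangle (0, a, a+b) is an antisymmetric 2-cocycle on Z^2,
   and these are bilinear: f(a, b) = det(a, b) f(e1, e2).  Two such unit triangles
   tile a unit square, whose total is 1, so f(e1, e2) = 1/2. *)

From Coquelicot Require Import Coquelicot.
Require Import Defs.
From Stdlib Require Import Reals Lra Lia ZArith List Permutation.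
From Stdlib Require Import Classical ClassicalEpsilon FunctionalExtensionality PropExtensionality.
Import ListNotations.
Open Scope R_scope.

(** * Riemann integrals up to finitely many points, step functions *)

(** A bond may run along an edge of the triangulation, where the density of a triangle is 1/2 on a
    set of positive length, so edges cannot be discarded as negligible. This shapes the winding
    number: it is assembled from signs with [sg 0 = 0], which gives exactly 1/2 on an edge, and its
    antisymmetry and additivity are identities at every point, for degenerate triangles too.
    Vertices and transversal crossings of edge lines are finitely many on a bond and are dropped, so
    no angle at a vertex is ever computed. At every other point of a bond [density] is constant for
    small radii, and [chi] reduces to the areas of a disc and of a half-disc. On an edge parallel to
    [r] the derivative [Dr] is taken along the edge, hence is the same for the triangles on both
    sides. Assumption (A2) turns the sum over the bonds of $\mathcal B$ into a sum over all of
    $\mathbb Z^2$: bonds outside $\mathcal B$ miss the closure of $\Omega_c$ and contribute 0. Only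
    the full lattice sum has the invariance under translations and reflections. *)

Lemma RInt_unique (f : R -> R) (a b v : R) : is_RInt f a b v -> RInt f a b = v.
Proof.
  intros H. unfold RInt.
  destruct excluded_middle_informative as [h | h].
  (* Whichever integrability proof [epsilon] selects, [RInt_Reals] gives the same value, so all
     integrals can be handled through [is_RInt]. *)
  - rewrite <- RInt_Reals. apply is_RInt_unique, H.
  - exfalso. apply h. constructor. apply ex_RInt_Reals_0. exists v. exact H.
Qed.

Lemma is_RInt_eq (f : R -> R) (a b v w : R) : is_RInt f a b v -> v = w -> is_RInt f a b w.
Proof. now intros H <-. Qed.

Lemma is_RInt_ext_open (f g : R -> R) (a b v : R) : a <= b ->
  (forall x, a < x < b -> f x = g x) -> is_RInt f a b v -> is_RInt g a b v.
Proof.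
  intros Hab H. apply is_RInt_ext. intros x. rewrite Rmin_left, Rmax_right by exact Hab.
  apply H.
Qed.

Lemma is_RInt_join (f : R -> R) (a b c v w : R) :
  is_RInt f a b v -> is_RInt f b c w -> is_RInt f a c (v + w).
Proof. exact (is_RInt_Chasles (V := R_NormedModule) f a b c v w). Qed.

Lemma is_RInt_add (f g : R -> R) (a b v w : R) :
  is_RInt f a b v -> is_RInt g a b w -> is_RInt (fun x => f x + g x) a b (v + w).
Proof. exact (is_RInt_plus (V := R_NormedModule) f g a b v w). Qed.

Lemma is_RInt_mult_l (f : R -> R) (a b k v : R) :
  is_RInt f a b v -> is_RInt (fun x => k * f x) a b (k * v).
Proof. exact (is_RInt_scal (V := R_NormedModule) f a b k v). Qed.

Lemma is_RInt_cst (a b v : R) : is_RInt (fun _ : R => v) a b ((b - a) * v).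
Proof. exact (is_RInt_const (V := R_NormedModule) a b v). Qed.

Lemma is_RInt_zero (a b : R) : is_RInt (fun _ : R => 0) a b 0.
Proof. apply is_RInt_eq with ((b - a) * 0); [apply is_RInt_cst | ring]. Qed.

Lemma is_RInt_spike (a b c v : R) : a <= b ->
  is_RInt (fun x => if Req_EM_T x c then v else 0) a b 0.
Proof.
  intros Hab.
  assert (Z : forall p q, p <= q -> (q <= c \/ c <= p) ->
    is_RInt (fun x => if Req_EM_T x c then v else 0) p q 0).
  { intros p q Hpq Hc. apply is_RInt_ext_open with (fun _ : R => 0); [exact Hpq | |].
    - intros x Hx.
      destruct Req_EM_T; [lra | reflexivity].
    - apply is_RInt_zero. }
  destruct (Rle_dec c a); [apply Z; lra |].
  destruct (Rle_dec b c); [apply Z; lra |].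
  apply is_RInt_eq with (0 + 0); [| ring].
  apply is_RInt_join with c; apply Z; lra.
Qed.

(** Induction on the exceptional points: the value at the head is split off as a spike, which
    integrates to 0. *)
Lemma is_RInt_zero_off_list (l : list R) (f : R -> R) (a b : R) : a <= b ->
  (forall x, a < x < b -> ~ In x l -> f x = 0) -> is_RInt f a b 0.
Proof.
  intros Hab. revert f. induction l as [| c l IH]; intros f Hf.
  - apply is_RInt_ext_open with (fun _ : R => 0); [exact Hab | |].
    + intros x Hx.
      symmetry. apply Hf; [lra | auto].
    + apply is_RInt_zero.
  - apply is_RInt_ext_open with
      (fun x => (if Req_EM_T x c then f c else 0) + (if Req_EM_T x c then 0 else f x));
      [exact Hab | |].
    + intros x _. destruct Req_EM_T; [subst |]; ring.
    + apply is_RInt_eq with (0 + 0); [| ring].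
      apply is_RInt_add; [apply is_RInt_spike, Hab |].
      apply IH. intros x Hx Hn. destruct Req_EM_T as [-> | Hne]; [reflexivity |].
      apply Hf; [exact Hx |]. intros [E | E]; [congruence | exact (Hn E)].
Qed.

Lemma is_RInt_ext_off_list (l : list R) (f g : R -> R) (a b v : R) : a <= b ->
  (forall x, a < x < b -> ~ In x l -> f x = g x) -> is_RInt f a b v -> is_RInt g a b v.
Proof.
  intros Hab Hfg Hf.
  apply is_RInt_ext_open with (fun x => f x + (g x - f x)); [exact Hab | |].
  - intros x _. ring.
  - apply is_RInt_eq with (v + 0); [| ring].
    apply is_RInt_add; [exact Hf |].
    apply is_RInt_zero_off_list with l; [exact Hab |].
    intros x Hx Hn. rewrite (Hfg x Hx Hn). ring.
Qed.

(** The list only has to contain the possible jumps, in any order, and the values at the listed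
    points are free. Step functions can therefore be combined by appending their lists. *)
Definition step_off {V : Type} (l : list R) (f : R -> V) : Prop :=
  forall x z, x < z -> (forall c, In c l -> ~ (x <= c <= z)) -> f x = f z.

Lemma step_off_map {U V : Type} (h : U -> V) l f : step_off l f -> step_off l (fun x => h (f x)).
Proof. intros H x z Hxz Hl. now rewrite (H x z Hxz Hl). Qed.

Lemma step_off_map2 {U V X : Type} (h : U -> V -> X) l l' f g :
  step_off l f -> step_off l' g -> step_off (l ++ l') (fun x => h (f x) (g x)).
Proof.
  intros Hf Hg x z Hxz Hl.
  rewrite (Hf x z Hxz), (Hg x z Hxz); [reflexivity | |];
    intros c Hc; apply Hl, in_or_app; auto.
Qed.

Lemma ex_RInt_step (l : list R) (f : R -> R) (a b : R) : a <= b ->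
  step_off l f -> ex_RInt f a b.
Proof.
  intros Hab Hs.
  (* The hypothesis is restricted to the open interval so that the induction can cut it at the head
     of the list and forget that point. *)
  assert (G : forall (l : list R) a b, a <= b ->
    (forall x z, a < x -> x < z -> z < b ->
       (forall c, In c l -> ~ (x <= c <= z)) -> f x = f z) -> ex_RInt f a b).
  { clear. induction l as [| c l IH]; intros a b Hab H.
    - exists ((b - a) * f ((a + b) / 2)).
      apply is_RInt_ext_open with (fun _ : R => f ((a + b) / 2));
        [exact Hab | | apply is_RInt_cst].
      intros x Hx.
      destruct (Rtotal_order x ((a + b) / 2)) as [E | [E | E]].
      + symmetry. apply H; try lra. intros c [].
      + now rewrite <- E.
      + apply H; try lra. intros c [].
    - destruct (Rlt_dec a c) as [Hac | Hac]; [destruct (Rlt_dec c b) as [Hcb | Hcb] |].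
      + apply ex_RInt_Chasles with c; apply IH; try lra; intros x z H1 H2 H3 H4;
          apply H; try lra; intros d [<- | Hd]; [lra | auto | lra | auto].
      + apply IH; [lra |]. intros x z H1 H2 H3 H4.
        apply H; try lra; intros d [<- | Hd]; [lra | auto].
      + apply IH; [lra |]. intros x z H1 H2 H3 H4.
        apply H; try lra; intros d [<- | Hd]; [lra | auto]. }
  apply (G l a b Hab). intros x z _ Hxz _ Hl. now apply Hs.
Qed.

(** * Signs of affine functions *)

(** Integer-valued, so that identities between signs can be settled by enumeration and [lia]. *)
Definition sg (x : R) : Z :=
  if Rlt_dec x 0 then (-1)%Z else if Rlt_dec 0 x then 1%Z else 0%Z.

Lemma sg_spec x : (x < 0 /\ sg x = (-1)%Z) \/ (x = 0 /\ sg x = 0%Z) \/ (0 < x /\ sg x = 1%Z).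
Proof. unfold sg. destruct (Rlt_dec x 0), (Rlt_dec 0 x); intuition lra. Qed.

Lemma sg_pos x : 0 < x -> sg x = 1%Z.
Proof. destruct (sg_spec x) as [[]|[[]|[]]]; intros; auto; lra. Qed.
Lemma sg_neg x : x < 0 -> sg x = (-1)%Z.
Proof. destruct (sg_spec x) as [[]|[[]|[]]]; intros; auto; lra. Qed.
Lemma sg_0 : sg 0 = 0%Z.
Proof. destruct (sg_spec 0) as [[]|[[]|[]]]; auto; lra. Qed.

Lemma sg_opp x : sg (- x) = (- sg x)%Z.
Proof.
  destruct (sg_spec x) as [[H ->]|[[-> ->]|[H ->]]].
  - apply sg_pos; lra.
  - rewrite Ropp_0. apply sg_0.
  - apply sg_neg; lra.
Qed.

Lemma sg_mult x z : sg (x * z) = (sg x * sg z)%Z.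
Proof.
  destruct (sg_spec x) as [[H ->]|[[-> ->]|[H ->]]];
  [| rewrite Rmult_0_l; apply sg_0 |];
  (destruct (sg_spec z) as [[H' ->]|[[-> ->]|[H' ->]]];
   [| rewrite Rmult_0_r; apply sg_0 |]);
  first [rewrite sg_pos by nra; reflexivity | rewrite sg_neg by nra; reflexivity].
Qed.

(** For [p = 0] the list is empty even if [q = 0]: an affine function that vanishes identically has
    no isolated root. This is the case of a bond lying on an edge line, which must not be treated as
    exceptional. *)
Definition root (p q : R) : list R := if Req_EM_T p 0 then [] else [- q / p].

Lemma affine_off_root (p q l : R) : ~ In l (root p q) -> p * l + q = 0 -> p = 0 /\ q = 0.
Proof.
  unfold root. destruct Req_EM_T as [-> | Hp]; intros Hn H.
  - split; [reflexivity | lra].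
  - exfalso. apply Hn. left. apply (Rmult_eq_reg_l p); [field_simplify; lra | exact Hp].
Qed.

Lemma step_off_affine (p q : R) : step_off (root p q) (fun l => sg (p * l + q)).
Proof.
  intros x z Hxz Hl. unfold root in Hl. destruct Req_EM_T as [-> | Hp].
  - f_equal. ring.
  - specialize (Hl _ (or_introl eq_refl)).
    assert (E : forall t, p * t + q = p * (t - - q / p)) by (intros; field; exact Hp).
    rewrite !E, !sg_mult. f_equal.
    set (c := - q / p) in *.
    destruct (Rlt_dec c x); [now rewrite !sg_pos by lra |].
    destruct (Rlt_dec z c); [now rewrite !sg_neg by lra | lra].
Qed.

(** * Finitely supported sums over the lattice *)

Lemma sum_list_app {A} (f : A -> R) l l' : sum_list f (l ++ l') = sum_list f l + sum_list f l'.
Proof. induction l as [| a l IH]; simpl; [| rewrite IH]; ring. Qed.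

Lemma sum_list_ext {A} (f g : A -> R) l :
  (forall a, In a l -> f a = g a) -> sum_list f l = sum_list g l.
Proof.
  induction l as [| a l IH]; simpl; intros H; [reflexivity |].
  rewrite (H a), IH; auto.
Qed.

Lemma sum_list_add {A} (f g : A -> R) l :
  sum_list (fun a => f a + g a) l = sum_list f l + sum_list g l.
Proof. induction l as [| a l IH]; simpl; [| rewrite IH]; ring. Qed.

Lemma sum_list_mult_l {A} (f : A -> R) k l :
  sum_list (fun a => k * f a) l = k * sum_list f l.
Proof. induction l as [| a l IH]; simpl; [| rewrite IH]; ring. Qed.

Lemma sum_list_0 {A} (l : list A) : sum_list (fun _ => 0) l = 0.
Proof. induction l as [| a l IH]; simpl; [| rewrite IH]; ring. Qed.

Lemma sum_list_zero {A} (f : A -> R) l : (forall a, In a l -> f a = 0) -> sum_list f l = 0.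
Proof. intros H. rewrite (sum_list_ext f (fun _ => 0)); [apply sum_list_0 | exact H]. Qed.

Lemma sum_list_swap {A B} (f : A -> B -> R) l l' :
  sum_list (fun a => sum_list (f a) l') l = sum_list (fun b => sum_list (fun a => f a b) l) l'.
Proof.
  induction l as [| a l IH]; simpl; [now rewrite sum_list_0 |].
  now rewrite IH, <- sum_list_add.
Qed.

Lemma sum_list_map {A B} (h : A -> B) (f : B -> R) l :
  sum_list f (map h l) = sum_list (fun a => f (h a)) l.
Proof. induction l as [| a l IH]; simpl; [| rewrite IH]; ring. Qed.

Lemma sum_list_perm {A} (f : A -> R) l l' : Permutation l l' -> sum_list f l = sum_list f l'.
Proof. induction 1; simpl; lra. Qed.

Lemma sum_list_single {A} (f : A -> R) l a : NoDup l -> In a l ->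
  (forall b, In b l -> b <> a -> f b = 0) -> sum_list f l = f a.
Proof.
  intros Hl Ha. destruct (in_split a l Ha) as (l1 & l2 & ->). intros H.
  apply NoDup_remove_2 in Hl. rewrite sum_list_app. simpl.
  rewrite !sum_list_zero; [ring | |]; intros b Hb; apply H;
    try (apply in_or_app; simpl; auto); intros ->; apply Hl, in_or_app; auto.
Qed.

Lemma sum_list_pair {A} (f : A -> R) l a a' : NoDup l -> In a l -> In a' l -> a <> a' ->
  (forall b, In b l -> b <> a -> b <> a' -> f b = 0) -> sum_list f l = f a + f a'.
Proof.
  intros Hl Ha Ha' Hne H. destruct (in_split a l Ha) as (l1 & l2 & ->).
  rewrite sum_list_app. simpl.
  replace (f a + f a') with (f a + sum_list f (l1 ++ l2)).
  { rewrite sum_list_app. ring. }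
  f_equal. apply sum_list_single.
  - now apply NoDup_remove_1 in Hl.
  - apply in_app_or in Ha'. apply in_or_app. destruct Ha' as [E | [E | E]]; auto. now elim Hne.
  - apply NoDup_remove_2 in Hl. intros b Hb Hba'. apply H; [| | exact Hba'].
    + apply in_app_or in Hb. apply in_or_app; simpl; tauto.
    + intros ->. now apply Hl.
Qed.

(** With their zero terms filtered out, the two lists are permutations of each other. *)
Lemma sum_list_support {A} (f : A -> R) l l' : NoDup l -> NoDup l' ->
  (forall a, f a <> 0 -> In a l) -> (forall a, f a <> 0 -> In a l') ->
  sum_list f l = sum_list f l'.
Proof.
  intros Hl Hl' H H'.
  set (p := fun a => if Req_EM_T (f a) 0 then false else true).
  assert (E : forall l, sum_list f l = sum_list f (filter p l)).
  { intros k. induction k as [| a k IH]; simpl; [reflexivity |].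
    unfold p at 1. destruct Req_EM_T as [E | E]; simpl; rewrite IH; [rewrite E |]; ring. }
  rewrite (E l), (E l'). apply sum_list_perm, NoDup_Permutation; try now apply NoDup_filter.
  intros a. rewrite !filter_In. unfold p. destruct Req_EM_T as [Ea | Ea]; [easy |].
  split; intros _; auto.
Qed.

(** A sum over the whole lattice, witnessed by any duplicate-free list that contains the support;
    the value does not depend on the list. *)
Definition is_sum (F : zpt -> R) (s : R) : Prop :=
  exists L, NoDup L /\ (forall i, F i <> 0 -> In i L) /\ sum_list F L = s.

Lemma is_sum_list F s L : is_sum F s -> NoDup L -> (forall i, F i <> 0 -> In i L) ->
  sum_list F L = s.
Proof. intros (L' & HL' & H' & <-) HL H. now apply sum_list_support. Qed.

Lemma is_sum_unique F s s' : is_sum F s -> is_sum F s' -> s = s'.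
Proof. intros H (L & HL & HF & <-). symmetry. now apply is_sum_list. Qed.

Lemma is_sum_ext F G s : (forall i, F i = G i) -> is_sum F s -> is_sum G s.
Proof.
  intros E (L & HL & H & <-). exists L. split; [exact HL |]. split.
  - intros i. rewrite <- E. apply H.
  - apply sum_list_ext. intros i _. symmetry. apply E.
Qed.

Lemma is_sum_zero : is_sum (fun _ => 0) 0.
Proof. exists []. split; [constructor |]. split; [intros; lra | reflexivity]. Qed.

Lemma zpt_eq_dec (i j : zpt) : {i = j} + {i <> j}.
Proof. decide equality; apply Z.eq_dec. Qed.

Lemma is_sum_add F G s t : is_sum F s -> is_sum G t -> is_sum (fun i => F i + G i) (s + t).
Proof.
  intros HF HG. pose proof HF as (L & _ & HL & _). pose proof HG as (K & _ & HK & _).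
  assert (N : NoDup (nodup zpt_eq_dec (L ++ K))) by apply NoDup_nodup.
  assert (HF' : forall i, F i <> 0 -> In i (nodup zpt_eq_dec (L ++ K)))
    by (intros; apply nodup_In, in_or_app; auto).
  assert (HG' : forall i, G i <> 0 -> In i (nodup zpt_eq_dec (L ++ K)))
    by (intros; apply nodup_In, in_or_app; auto).
  exists (nodup zpt_eq_dec (L ++ K)). split; [exact N |]. split.
  - intros i Hi. destruct (Req_dec (F i) 0) as [E | E]; [| auto].
    apply HG'. rewrite E in Hi. lra.
  - rewrite sum_list_add. f_equal; now apply is_sum_list.
Qed.

Lemma is_sum_mult_l F k s : is_sum F s -> is_sum (fun i => k * F i) (k * s).
Proof.
  intros (L & HL & H & <-). exists L. split; [exact HL |]. split.
  - intros i Hi. apply H. intros E. apply Hi. rewrite E. ring.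
  - apply sum_list_mult_l.
Qed.

Lemma is_sum_sum_list {A} (F : A -> zpt -> R) (s : A -> R) l :
  (forall a, In a l -> is_sum (F a) (s a)) ->
  is_sum (fun i => sum_list (fun a => F a i) l) (sum_list s l).
Proof.
  induction l as [| a l IH]; intros H; simpl; [apply is_sum_zero |].
  apply is_sum_add; [apply H; now left | apply IH; intros; apply H; now right].
Qed.

Lemma is_sum_reindex F s (h g : zpt -> zpt) :
  (forall i, h (g i) = i) -> (forall i, g (h i) = i) ->
  is_sum F s -> is_sum (fun i => F (h i)) s.
Proof.
  intros E E' (L & HL & H & <-). exists (map g L). split; [| split].
  - apply FinFun.Injective_map_NoDup; [| exact HL].
    intros a b Hab. now rewrite <- (E a), <- (E b), Hab.
  - intros i Hi. rewrite <- (E' i). apply in_map, H, Hi.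
  - rewrite sum_list_map. apply sum_list_ext. intros i _. now rewrite E.
Qed.

Definition zrange (N : nat) : list Z := map (fun k => (Z.of_nat k - Z.of_nat N)%Z) (seq 0 (2 * N + 1)).
Definition zbox (N : nat) : list zpt := list_prod (zrange N) (zrange N).

Lemma zrange_NoDup N : NoDup (zrange N).
Proof. apply FinFun.Injective_map_NoDup; [intros a b H; lia | apply seq_NoDup]. Qed.

Lemma zrange_In N k : (Z.abs k <= Z.of_nat N)%Z -> In k (zrange N).
Proof.
  intros H. apply in_map_iff. exists (Z.to_nat (k + Z.of_nat N)).
  split; [| apply in_seq]; lia.
Qed.

Lemma list_prod_NoDup {A B} (l : list A) (l' : list B) :
  NoDup l -> NoDup l' -> NoDup (list_prod l l').
Proof.
  intros Hl Hl'. induction Hl as [| a l Ha Hl IH]; simpl; [constructor |].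
  apply NoDup_app; [| exact IH |].
  - apply FinFun.Injective_map_NoDup; [intros b c H; now inversion H | exact Hl'].
  - intros [b c] Hb Hc. apply in_map_iff in Hb as (d & [= <- <-] & _).
    apply in_prod_iff in Hc. tauto.
Qed.

Lemma zbox_NoDup N : NoDup (zbox N).
Proof. apply list_prod_NoDup; apply zrange_NoDup. Qed.

Lemma zbox_In N i : (Z.abs (fst i) <= Z.of_nat N)%Z -> (Z.abs (snd i) <= Z.of_nat N)%Z ->
  In i (zbox N).
Proof. destruct i. intros. now apply in_prod; apply zrange_In. Qed.

Lemma sum_list_prod_mult {A B} (f : A -> R) (g : B -> R) l l' :
  sum_list (fun p => f (fst p) * g (snd p)) (list_prod l l') = sum_list f l * sum_list g l'.
Proof.
  induction l as [| a l IH]; simpl; [ring |].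
  rewrite sum_list_app, IH, sum_list_map. simpl. rewrite sum_list_mult_l. ring.
Qed.

Lemma zrange_telescope (f : R -> R) N :
  sum_list (fun k => f (IZR k) - f (IZR k - 1)) (zrange N) = f (INR N) - f (- INR N - 1).
Proof.
  unfold zrange. rewrite sum_list_map.
  assert (G : forall n, sum_list (fun k => f (IZR (Z.of_nat k - Z.of_nat N)) -
      f (IZR (Z.of_nat k - Z.of_nat N) - 1)) (seq 0 n) =
      f (IZR (Z.of_nat n - Z.of_nat N - 1)) - f (- INR N - 1)).
  { induction n as [| n IH].
    - rewrite !minus_IZR, <- !INR_IZR_INZ. simpl. rewrite Rminus_0_l. ring.
    - rewrite seq_S, sum_list_app, IH. unfold sum_list. cbn [fold_right Nat.add].
      replace (Z.of_nat (S n) - Z.of_nat N - 1)%Z with (Z.of_nat n - Z.of_nat N)%Z by lia.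
      rewrite (minus_IZR (Z.of_nat n - Z.of_nat N) 1). ring. }
  rewrite G. do 2 f_equal. rewrite INR_IZR_INZ. f_equal. lia.
Qed.

(** * Winding numbers of lattice triangles *)

Definition is_sign (s : Z) : Prop := s = (-1)%Z \/ s = 0%Z \/ s = 1%Z.
Lemma sg_is_sign x : is_sign (sg x).
Proof. unfold is_sign. destruct (sg_spec x) as [[]|[[]|[]]]; auto. Qed.

(** Four times the winding number as a function of six signs: [a], [b], [c] of the horizontal
    offsets of the vertices from the point, and [p], [q], [s] of the determinants of the edges
    opposite to them. *)
Definition winding_signs (a b c p q s : Z) : Z :=
  (Z.abs (b - a) * s + Z.abs (c - b) * p + Z.abs (a - c) * q)%Z.

(** The sign patterns that three reals with sum 0 cannot have. *)
Definition one_signed (a b c : Z) : Prop :=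
  ((0 <= a /\ 0 <= b /\ 0 <= c /\ 0 < a + b + c) \/
   (a <= 0 /\ b <= 0 /\ c <= 0 /\ a + b + c < 0))%Z.

Lemma one_signed_sg x y z : x + y + z = 0 -> ~ one_signed (sg x) (sg y) (sg z).
Proof.
  intros H. unfold one_signed.
  destruct (sg_spec x) as [[? ->]|[[? ->]|[? ->]]], (sg_spec y) as [[? ->]|[[? ->]|[? ->]]],
    (sg_spec z) as [[? ->]|[[? ->]|[? ->]]]; try lia; exfalso; lra.
Qed.

(** A check of all 3^6 sign patterns. The hypothesis on the products records the barycentric
    relation, by which the offsets weighted with the edge determinants add up to 0; it is the only
    geometry involved. The values 0, 4 and 2 stand for outside, inside and on an edge. *)
Lemma winding_signs_cases (a b c p q s : Z) :
  is_sign a -> is_sign b -> is_sign c -> is_sign p -> is_sign q -> is_sign s ->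
  ~ one_signed (p * a) (q * b) (s * c) ->
  (~ one_signed p q s -> winding_signs a b c p q s = 0%Z) /\
  (~ (a = 0 /\ b = 0 /\ c = 0)%Z -> p = 1%Z -> q = 1%Z -> s = 1%Z -> winding_signs a b c p q s = 4%Z) /\
  (~ (a = 0 /\ b = 0 /\ c = 0)%Z -> (p + q + s)%Z = 2%Z -> winding_signs a b c p q s = 2%Z).
Proof.
  unfold is_sign, one_signed.
  intros [-> | [-> | ->]] [-> | [-> | ->]] [-> | [-> | ->]]
         [-> | [-> | ->]] [-> | [-> | ->]] [-> | [-> | ->]];
    cbn; intros; repeat split; intros; lia.
Qed.

(** The determinant of [P - x] and [Q - x], twice the signed area of the triangle with vertices [x],
    [P], [Q]. *)
Definition cr (P Q : zpt) (x : pt) : R :=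
  (IZR (fst P) - fst x) * (IZR (snd Q) - snd x) - (IZR (snd P) - snd x) * (IZR (fst Q) - fst x).

(* Crossing number of the edge with the vertical line through [x], signed by the side
   on which [x] lies.  Because [sg 0 = 0], the sum over the edges of a triangle
   is, off its vertices, 4 times the signed density: 2 on edges. *)
Definition edge_winding (P Q : zpt) (x : pt) : Z :=
  (Z.abs (sg (IZR (fst Q) - fst x) - sg (IZR (fst P) - fst x)) * sg (cr P Q x))%Z.

Definition winding (A B C : zpt) (x : pt) : R :=
  IZR (edge_winding A B x + edge_winding B C x + edge_winding C A x) / 4.

Lemma edge_winding_swap P Q x : edge_winding Q P x = (- edge_winding P Q x)%Z.
Proof.
  unfold edge_winding. replace (cr Q P x) with (- cr P Q x) by (unfold cr; ring).
  rewrite sg_opp. rewrite <- Z.abs_opp. rewrite Z.mul_opp_r. do 2 f_equal. f_equal. ring.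
Qed.

Lemma winding_swap A B C x : winding A C B x = - winding A B C x.
Proof.
  unfold winding. rewrite (edge_winding_swap C A), (edge_winding_swap B C), (edge_winding_swap A B).
  rewrite !plus_IZR, !opp_IZR. field.
Qed.

Lemma winding_cocycle O A B C x :
  winding A B C x = winding O A B x + winding O B C x + winding O C A x.
Proof.
  unfold winding.
  rewrite (edge_winding_swap O A), (edge_winding_swap O B), (edge_winding_swap O C).
  rewrite !plus_IZR, !opp_IZR. field.
Qed.

Lemma winding_rot A B C x : winding B C A x = winding A B C x.
Proof. unfold winding. do 2 f_equal. ring. Qed.

Lemma winding_outside A B C x :
  ~ one_signed (sg (cr B C x)) (sg (cr C A x)) (sg (cr A B x)) -> winding A B C x = 0.
Proof.
  intros H.
  assert (E : winding_signs (sg (IZR (fst A) - fst x)) (sg (IZR (fst B) - fst x))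
    (sg (IZR (fst C) - fst x)) (sg (cr B C x)) (sg (cr C A x)) (sg (cr A B x)) = 0%Z).
  { apply winding_signs_cases; try apply sg_is_sign; [| exact H].
    (* First coordinate of the barycentric relation [cr B C x] (A - x) + [cr C A x] (B - x) +
       [cr A B x] (C - x) = 0. *)
    rewrite <- !sg_mult. apply one_signed_sg. unfold cr. ring. }
  unfold winding. unfold winding_signs in E. unfold edge_winding.
  rewrite E. field.
Qed.

Definition zneg (i : zpt) : zpt := ((- fst i)%Z, (- snd i)%Z).
Definition pneg (x : pt) : pt := (- fst x, - snd x).

Lemma winding_translate A B C v x :
  winding (zadd A v) (zadd B v) (zadd C v) (padd x (inj v)) = winding A B C x.
Proof.
  assert (H : forall P Q, edge_winding (zadd P v) (zadd Q v) (padd x (inj v)) = edge_winding P Q x).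
  { intros P Q. unfold edge_winding, cr, zadd, padd, inj. simpl. rewrite !plus_IZR.
    f_equal; [f_equal; f_equal |]; f_equal; ring. }
  unfold winding. now rewrite !H.
Qed.

(** The reflection preserves determinants and negates the horizontal offsets, which enter only
    through the absolute value of a difference. *)
Lemma winding_reflect A B C x :
  winding (zneg A) (zneg B) (zneg C) (pneg x) = winding A B C x.
Proof.
  assert (H : forall P Q, edge_winding (zneg P) (zneg Q) (pneg x) = edge_winding P Q x).
  { intros P Q. unfold edge_winding, cr, zneg, pneg. simpl. rewrite !opp_IZR.
    replace (- IZR (fst Q) - - fst x) with (- (IZR (fst Q) - fst x)) by ring.
    replace (- IZR (fst P) - - fst x) with (- (IZR (fst P) - fst x)) by ring.
    rewrite !sg_opp, <- Z.abs_opp. f_equal; f_equal; ring. }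
  unfold winding. now rewrite !H.
Qed.

Definition bond_pt (i r : zpt) (l : R) : pt := seg_pt (inj i) (inj (zadd i r)) l.

Lemma bond_pt_eq i r l :
  bond_pt i r l = (IZR (fst r) * l + IZR (fst i), IZR (snd r) * l + IZR (snd i)).
Proof.
  unfold bond_pt, seg_pt, padd, pscal, inj, zadd. simpl. rewrite !plus_IZR. f_equal; ring.
Qed.

Definition cr_slope (P Q r : zpt) : R :=
  IZR (snd r) * (IZR (fst Q) - IZR (fst P)) - IZR (fst r) * (IZR (snd Q) - IZR (snd P)).

Lemma cr_bond P Q i r l : cr P Q (bond_pt i r l) = cr_slope P Q r * l + cr P Q (inj i).
Proof. rewrite bond_pt_eq. unfold cr, cr_slope, inj. simpl. ring. Qed.

Lemma step_winding A B C i r : exists l, step_off l (fun t => winding A B C (bond_pt i r t)).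
Proof.
  assert (H : forall P Q, exists l, step_off l (fun t => edge_winding P Q (bond_pt i r t))).
  { intros P Q. eexists.
    apply step_off_map2 with (h := Z.mul);
      [apply (step_off_map Z.abs), (step_off_map2 Z.sub) |].
    - intros x z Hxz Hl. rewrite !bond_pt_eq. simpl.
      assert (E : forall t, IZR (fst Q) - (IZR (fst r) * t + IZR (fst i)) =
        - IZR (fst r) * t + (IZR (fst Q) - IZR (fst i))) by (intros; ring).
      rewrite !E. exact (step_off_affine _ _ x z Hxz Hl).
    - intros x z Hxz Hl. rewrite !bond_pt_eq. simpl.
      assert (E : forall t, IZR (fst P) - (IZR (fst r) * t + IZR (fst i)) =
        - IZR (fst r) * t + (IZR (fst P) - IZR (fst i))) by (intros; ring).
      rewrite !E. exact (step_off_affine _ _ x z Hxz Hl).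
    - intros x z Hxz Hl. rewrite !cr_bond. exact (step_off_affine _ _ x z Hxz Hl). }
  destruct (H A B) as [l1 H1], (H B C) as [l2 H2], (H C A) as [l3 H3].
  exists ((l1 ++ l2) ++ l3). apply (step_off_map (fun z => IZR z / 4)).
  apply (step_off_map2 Z.add); [apply (step_off_map2 Z.add) |]; assumption.
Qed.

(** * Averages of the winding number over bonds, and their totals over the lattice *)

Definition bond_winding (A B C r i : zpt) : R :=
  bond_avg (winding A B C) (inj i) (inj (zadd i r)).

Lemma bond_winding_is_RInt A B C r i :
  is_RInt (fun l => winding A B C (bond_pt i r l)) 0 1 (bond_winding A B C r i).
Proof.
  destruct (step_winding A B C i r) as [l H].
  destruct (ex_RInt_step l _ 0 1 Rle_0_1 H) as [v Hv].
  replace (bond_winding A B C r i) with v; [exact Hv |].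
  symmetry. exact (RInt_unique _ _ _ _ Hv).
Qed.

Lemma bond_winding_value A B C r i v :
  is_RInt (fun l => winding A B C (bond_pt i r l)) 0 1 v -> bond_winding A B C r i = v.
Proof. apply RInt_unique. Qed.

Lemma winding_far A B C K x :
  (forall P, P = A \/ P = B \/ P = C -> Rabs (IZR (fst P)) <= K /\ Rabs (IZR (snd P)) <= K) ->
  K < Rabs (fst x) \/ K < Rabs (snd x) -> winding A B C x = 0.
Proof.
  intros HK Hx. apply winding_outside.
  destruct (HK A) as [A1 A2]; [auto |]. destruct (HK B) as [B1 B2]; [auto |].
  destruct (HK C) as [C1 C2]; [auto |].
  (* If all vertices lie strictly on one side of a horizontal or vertical line through [x], the
     barycentric relation has coefficients [a], [b], [c] of one common sign, so the three
     determinants cannot be one-signed. *)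
  assert (G : forall s (a b c : R), is_sign s -> s <> 0%Z -> sg a = s -> sg b = s -> sg c = s ->
    cr B C x * a + cr C A x * b + cr A B x * c = 0 ->
    ~ one_signed (sg (cr B C x)) (sg (cr C A x)) (sg (cr A B x))).
  { intros s a b c Hs Hs0 Ha Hb Hc E. apply one_signed_sg in E.
    rewrite !sg_mult, Ha, Hb, Hc in E. intros H. apply E. unfold one_signed in *.
    destruct Hs as [-> | [-> | ->]]; lia. }
  apply Rabs_le_between in A1, A2, B1, B2, C1, C2.
  destruct Hx as [Hx | Hx]; unfold Rabs in Hx; destruct Rcase_abs in Hx.
  - apply (G 1%Z (IZR (fst A) - fst x) (IZR (fst B) - fst x) (IZR (fst C) - fst x));
      [unfold is_sign; auto | lia | apply sg_pos; lra | apply sg_pos; lra | apply sg_pos; lra |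
       unfold cr; ring].
  - apply (G (-1)%Z (IZR (fst A) - fst x) (IZR (fst B) - fst x) (IZR (fst C) - fst x));
      [unfold is_sign; auto | lia | apply sg_neg; lra | apply sg_neg; lra | apply sg_neg; lra |
       unfold cr; ring].
  - apply (G 1%Z (IZR (snd A) - snd x) (IZR (snd B) - snd x) (IZR (snd C) - snd x));
      [unfold is_sign; auto | lia | apply sg_pos; lra | apply sg_pos; lra | apply sg_pos; lra |
       unfold cr; ring].
  - apply (G (-1)%Z (IZR (snd A) - snd x) (IZR (snd B) - snd x) (IZR (snd C) - snd x));
      [unfold is_sign; auto | lia | apply sg_neg; lra | apply sg_neg; lra | apply sg_neg; lra |
       unfold cr; ring].
Qed.

Definition znorm (i : zpt) : Z := (Z.abs (fst i) + Z.abs (snd i))%Z.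

Lemma znorm_R P K : (znorm P <= K)%Z ->
  Rabs (IZR (fst P)) <= IZR K /\ Rabs (IZR (snd P)) <= IZR K.
Proof.
  unfold znorm. intros H. rewrite <- !abs_IZR. split; apply IZR_le; lia.
Qed.

Lemma ex_sum_bond_winding A B C r : exists s, is_sum (bond_winding A B C r) s.
Proof.
  set (K := (znorm A + znorm B + znorm C)%Z).
  (* [K] bounds the coordinates of the vertices, and a bond changes each coordinate by at most
     [znorm r]; a bond that starts outside this box stays away from the triangle. *)
  set (N := Z.to_nat (K + znorm r)).
  exists (sum_list (bond_winding A B C r) (zbox N)). exists (zbox N).
  split; [apply zbox_NoDup |]. split; [| reflexivity].
  intros i Hi. apply NNPP. intros Hn. apply Hi. apply bond_winding_value.
  apply is_RInt_ext_open with (fun _ => 0); [lra | | apply is_RInt_zero].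
  intros l Hl. symmetry. rewrite bond_pt_eq.
  apply winding_far with (IZR K).
  - intros P HP. apply znorm_R. unfold K, znorm. destruct HP as [-> | [-> | ->]]; lia.
  - assert (H : (K + znorm r < Z.abs (fst i) \/ K + znorm r < Z.abs (snd i))%Z).
    { destruct (Z_lt_le_dec (K + znorm r) (Z.abs (fst i))); [auto |].
      destruct (Z_lt_le_dec (K + znorm r) (Z.abs (snd i))); [auto |].
      exfalso. apply Hn, zbox_In; unfold N; lia. }
    destruct (znorm_R r (znorm r)) as [R1 R2]; [lia |].
    assert (G : forall a b : Z, Rabs (IZR a) <= IZR (znorm r) -> (K + znorm r < Z.abs b)%Z ->
      IZR K < Rabs (IZR a * l + IZR b)).
    { clear -Hl. intros a b Ha Hb. apply IZR_lt in Hb. rewrite plus_IZR, abs_IZR in Hb.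
      revert Ha Hb. unfold Rabs. repeat destruct Rcase_abs; intros; nra. }
    simpl. destruct H as [H | H]; [left | right]; now apply G.
Qed.

Definition total_winding (A B C r : zpt) : R :=
  epsilon (inhabits 0) (is_sum (bond_winding A B C r)).

Lemma total_winding_is_sum A B C r : is_sum (bond_winding A B C r) (total_winding A B C r).
Proof. exact (epsilon_spec (inhabits 0) _ (ex_sum_bond_winding A B C r)). Qed.

Lemma total_winding_value A B C r s :
  is_sum (bond_winding A B C r) s -> total_winding A B C r = s.
Proof. apply is_sum_unique, total_winding_is_sum. Qed.

Lemma total_winding_swap A B C r : total_winding A C B r = - total_winding A B C r.
Proof.
  apply total_winding_value. replace (- total_winding A B C r) with (-1 * total_winding A B C r) by ring.
  apply is_sum_ext with (fun i => -1 * bond_winding A B C r i);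
    [| apply is_sum_mult_l, total_winding_is_sum].
  intros i. symmetry. apply bond_winding_value.
  apply is_RInt_ext_open with (fun l => -1 * winding A B C (bond_pt i r l));
    [lra | | apply is_RInt_mult_l, bond_winding_is_RInt].
  intros l _. rewrite winding_swap. ring.
Qed.

Lemma total_winding_rot A B C r : total_winding B C A r = total_winding A B C r.
Proof.
  apply total_winding_value, is_sum_ext with (2 := total_winding_is_sum A B C r).
  intros i. symmetry. apply bond_winding_value.
  apply is_RInt_ext_open with (3 := bond_winding_is_RInt A B C r i); [lra |].
  intros l _. symmetry. apply winding_rot.
Qed.

Lemma total_winding_cocycle O A B C r :
  total_winding A B C r = total_winding O A B r + total_winding O B C r + total_winding O C A r.
Proof.
  apply total_winding_value.
  apply is_sum_ext with (fun i => bond_winding O A B r i + bond_winding O B C r i + bond_winding O C A r i);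
    [| apply is_sum_add; [apply is_sum_add |]; apply total_winding_is_sum].
  intros i. symmetry. apply bond_winding_value.
  apply is_RInt_ext_open with (fun l => winding O A B (bond_pt i r l) +
    winding O B C (bond_pt i r l) + winding O C A (bond_pt i r l));
    [lra | | apply is_RInt_add; [apply is_RInt_add |]; apply bond_winding_is_RInt].
  intros l _. symmetry. apply winding_cocycle.
Qed.

Lemma zpt_ext (a b : zpt) : fst a = fst b -> snd a = snd b -> a = b.
Proof. destruct a, b; simpl; congruence. Qed.

Ltac zpt_ring := apply zpt_ext; simpl; ring.

Lemma total_winding_translate A B C v r :
  total_winding (zadd A v) (zadd B v) (zadd C v) r = total_winding A B C r.
Proof.
  symmetry. apply total_winding_value.
  apply is_sum_ext with (fun i => bond_winding (zadd A v) (zadd B v) (zadd C v) r (zadd i v)).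
  - intros i. apply bond_winding_value.
    apply is_RInt_ext_open with (3 := bond_winding_is_RInt A B C r i); [lra |].
    intros l _. rewrite <- (winding_translate A B C v). f_equal.
    rewrite !bond_pt_eq. unfold padd, inj, zadd. simpl. rewrite !plus_IZR. f_equal; ring.
  - apply is_sum_reindex with (h := fun i => zadd i v) (g := fun i => zadd i (zneg v));
      [intros; zpt_ring | intros; zpt_ring | apply total_winding_is_sum].
Qed.

Lemma is_RInt_flip (f : R -> R) v : is_RInt f 0 1 v -> is_RInt (fun l => f (1 - l)) 0 1 v.
Proof.
  intros H. assert (H' : is_RInt f (-1 * 0 + 1) (-1 * 1 + 1) (- v)).
  { replace (-1 * 0 + 1) with 1 by ring. replace (-1 * 1 + 1) with 0 by ring.
    exact (is_RInt_swap (V := R_NormedModule) f 1 0 v H). }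
  apply (is_RInt_comp_lin (V := R_NormedModule)) in H'. apply (is_RInt_mult_l _ _ _ (-1)) in H'.
  apply is_RInt_eq with (-1 * - v); [| ring].
  apply is_RInt_ext_open with (3 := H'); [lra |].
  intros l _. unfold scal; simpl; unfold mult; simpl.
  replace (-1 * l + 1) with (1 - l) by ring. ring.
Qed.

(** The reflection carries the bond from [i] to [i + r] to the bond from [-(i + r)] to [-i],
    traversed backwards. The direction [r] is thus kept, at the price of the substitution [1 - l],
    and [i] is reindexed by an involution. *)
Lemma total_winding_reflect A B C r :
  total_winding (zneg A) (zneg B) (zneg C) r = total_winding A B C r.
Proof.
  symmetry. apply total_winding_value.
  apply is_sum_ext with (fun i => bond_winding (zneg A) (zneg B) (zneg C) r (zneg (zadd i r))).
  - intros i. apply bond_winding_value.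
    apply is_RInt_ext_open with
      (fun l => winding A B C (bond_pt i r (1 - l)));
      [lra | | apply (is_RInt_flip (fun l => winding A B C (bond_pt i r l))), bond_winding_is_RInt].
    intros l _. rewrite <- (winding_reflect A B C). f_equal.
    rewrite !bond_pt_eq. unfold pneg, zneg, zadd. simpl. rewrite !opp_IZR, !plus_IZR. f_equal; ring.
  - apply is_sum_reindex with (h := fun i => zneg (zadd i r)) (g := fun i => zneg (zadd i r));
      [intros; zpt_ring | intros; zpt_ring | apply total_winding_is_sum].
Qed.

(** * The bond density lemma *)

Definition step_winding_total (r a b : zpt) : R := total_winding (0, 0)%Z a (zadd a b) r.

(** Both sides are the total of the quadrilateral with vertices 0, a, a+b, a+b+c, cut along one
    diagonal or the other. *)
Lemma step_winding_total_cocycle r a b c :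
  step_winding_total r b c + step_winding_total r a (zadd b c)
  = step_winding_total r (zadd a b) c + step_winding_total r a b.
Proof.
  unfold step_winding_total.
  rewrite <- (total_winding_translate (0, 0)%Z b (zadd b c) a r).
  rewrite (total_winding_cocycle (0, 0)%Z).
  rewrite (total_winding_swap (0, 0)%Z (zadd (0, 0)%Z a)).
  replace (zadd (0, 0)%Z a) with a by zpt_ring.
  replace (zadd b a) with (zadd a b) by zpt_ring.
  replace (zadd (zadd b c) a) with (zadd (zadd a b) c) by zpt_ring.
  replace (zadd a (zadd b c)) with (zadd (zadd a b) c) by zpt_ring.
  ring.
Qed.

(** The point reflection z -> a+b-z sends the triangle (0, b, a+b) to (a+b, a, 0), which is (0, a,
    a+b) with the opposite orientation. *)
Lemma step_winding_total_antisym r a b : step_winding_total r b a = - step_winding_total r a b.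
Proof.
  unfold step_winding_total.
  rewrite <- (total_winding_reflect (0, 0)%Z b).
  rewrite <- (total_winding_translate _ _ _ (zadd a b)).
  replace (zadd (zneg (0, 0)%Z) (zadd a b)) with (zadd a b) by zpt_ring.
  replace (zadd (zneg b) (zadd a b)) with a by zpt_ring.
  replace (zadd (zneg (zadd b a)) (zadd a b)) with (0, 0)%Z by zpt_ring.
  rewrite <- total_winding_swap. apply total_winding_rot.
Qed.

(* An antisymmetric cocycle on an abelian group is bilinear: add up the three
   cyclic instances of the cocycle identity. *)
Lemma step_winding_total_additive r a b c :
  step_winding_total r (zadd a b) c = step_winding_total r a c + step_winding_total r b c.
Proof.
  assert (H1 := step_winding_total_cocycle r a b c).
  assert (H2 := step_winding_total_cocycle r b c a).
  assert (H3 := step_winding_total_cocycle r c a b).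
  rewrite (step_winding_total_antisym r (zadd b c) a) in H1.
  rewrite (step_winding_total_antisym r (zadd c a) b) in H2.
  rewrite (step_winding_total_antisym r (zadd a b) c) in H3.
  rewrite (step_winding_total_antisym r c a) in *.
  lra.
Qed.

Lemma step_winding_total_zmult r k a b :
  step_winding_total r ((k * fst a)%Z, (k * snd a)%Z) b = IZR k * step_winding_total r a b.
Proof.
  assert (S : forall k, step_winding_total r (((k + 1) * fst a)%Z, ((k + 1) * snd a)%Z) b =
    step_winding_total r ((k * fst a)%Z, (k * snd a)%Z) b + step_winding_total r a b).
  { intros j. rewrite <- step_winding_total_additive. f_equal. zpt_ring. }
  assert (S0 : step_winding_total r ((0 * fst a)%Z, (0 * snd a)%Z) b = 0).
  { assert (H := step_winding_total_additive r (0, 0)%Z (0, 0)%Z b). simpl in *.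
    unfold zadd at 1 in H. simpl in H. lra. }
  (* By [S] the claims for [k] and [k + 1] are equivalent, so the induction runs from 0 in both
     directions. *)
  revert k. apply Z.bi_induction.
  - intros x z ->. tauto.
  - rewrite S0. ring.
  - intros k. unfold Z.succ. rewrite S, plus_IZR. lra.
Qed.

Lemma step_winding_total_det r a b :
  step_winding_total r a b = IZR (fst a * snd b - snd a * fst b) *
                             step_winding_total r (1, 0)%Z (0, 1)%Z.
Proof.
  assert (E : forall a, a = zadd ((fst a * 1)%Z, (fst a * 0)%Z) ((snd a * 0)%Z, (snd a * 1)%Z))
    by (intros; zpt_ring).
  assert (L : forall a b, step_winding_total r a b =
    IZR (fst a) * step_winding_total r (1, 0)%Z b + IZR (snd a) * step_winding_total r (0, 1)%Z b).
  { intros u v. rewrite (E u) at 1. rewrite step_winding_total_additive.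
    rewrite <- (step_winding_total_zmult r (fst u) (1, 0)%Z),
            <- (step_winding_total_zmult r (snd u) (0, 1)%Z). reflexivity. }
  assert (D : forall u, step_winding_total r u u = 0).
  { intros u. assert (H := step_winding_total_antisym r u u). lra. }
  rewrite L, (step_winding_total_antisym r b (1, 0)%Z), (step_winding_total_antisym r b (0, 1)%Z).
  rewrite (L b), (L b (0, 1)%Z), !D, (step_winding_total_antisym r (1, 0)%Z (0, 1)%Z).
  rewrite minus_IZR, !mult_IZR. ring.
Qed.

(** * The unit square and the normalising constant *)

(** [half_sg u - half_sg (u - 1)] is the indicator of the unit interval with the value 1/2 at both
    ends. Its integer translates telescope to 1 everywhere, integers included. *)
Definition half_sg (u : R) : R := IZR (sg u) / 2.

(** The diagonal is run through in both directions and cancels, and vertical edges have crossing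
    factor 0. The two horizontal edges share the factor in [fst x], and their signs give the factor
    in [snd x]. *)
Lemma unit_square_winding x :
  winding (0, 0)%Z (1, 0)%Z (1, 1)%Z x + winding (0, 0)%Z (1, 1)%Z (0, 1)%Z x =
  (half_sg (fst x) - half_sg (fst x - 1)) * (half_sg (snd x) - half_sg (snd x - 1)).
Proof.
  unfold winding, edge_winding, half_sg, cr. simpl.
  set (u := fst x). set (v := snd x).
  replace (1 - u - (1 - u)) with 0 by ring.
  replace ((0 - u) * (0 - v) - (0 - v) * (1 - u)) with v by ring.
  replace ((1 - u) * (1 - v) - (0 - v) * (1 - u)) with (1 - u) by ring.
  replace ((1 - u) * (1 - v) - (1 - v) * (0 - u)) with (1 - v) by ring.
  replace ((0 - u) * (0 - v) - (1 - v) * (0 - u)) with (- (0 - u)) by ring.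
  replace ((1 - u) * (0 - v) - (1 - v) * (0 - u)) with (u - v) by ring.
  replace ((0 - u) * (1 - v) - (0 - v) * (1 - u)) with (- (u - v)) by ring.
  rewrite <- (Ropp_minus_distr u 1), <- (Ropp_minus_distr v 1), (Rminus_0_l u).
  rewrite !Z.sub_diag, !sg_opp.
  destruct (sg_spec u) as [[? ->]|[[? ->]|[? ->]]], (sg_spec v) as [[? ->]|[[? ->]|[? ->]]],
    (sg_spec (u - 1)) as [[? ->]|[[? ->]|[? ->]]], (sg_spec (v - 1)) as [[? ->]|[[? ->]|[? ->]]],
    (sg_spec (u - v)) as [[? ->]|[[? ->]|[? ->]]]; try lra; simpl; lra.
Qed.

Lemma half_sg_sum u N : Rabs u < INR N ->
  sum_list (fun k => half_sg (u + IZR k) - half_sg (u + IZR k - 1)) (zrange N) = 1.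
Proof.
  intros H. apply Rabs_def2 in H.
  rewrite (sum_list_ext _ (fun k => half_sg (u + IZR k) - half_sg (u + (IZR k - 1)))).
  - rewrite (zrange_telescope (fun t => half_sg (u + t))).
    unfold half_sg. rewrite (sg_pos (u + INR N)), (sg_neg (u + (- INR N - 1))) by lra. simpl. lra.
  - intros k _. do 2 f_equal. ring.
Qed.

Lemma is_RInt_sum_list {A} (f : A -> R -> R) (s : A -> R) l a b :
  (forall t, In t l -> is_RInt (f t) a b (s t)) ->
  is_RInt (fun x => sum_list (fun t => f t x) l) a b (sum_list s l).
Proof.
  induction l as [| t l IH]; intros H; simpl; [apply is_RInt_zero |].
  apply is_RInt_add; [apply H; now left | apply IH; intros; apply H; now right].
Qed.

Lemma is_RInt_det (f : R -> R) a b v w : is_RInt f a b v -> is_RInt f a b w -> v = w.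
Proof. intros Hv Hw. rewrite <- (RInt_unique _ _ _ _ Hv). now apply RInt_unique. Qed.

Lemma step_winding_total_unit r : step_winding_total r (1, 0)%Z (0, 1)%Z = 1 / 2.
Proof.
  assert (H : step_winding_total r (1, 0)%Z (0, 1)%Z - step_winding_total r (0, 1)%Z (1, 0)%Z = 1);
    [| rewrite (step_winding_total_antisym r (1, 0)%Z (0, 1)%Z) in H; lra].
  unfold step_winding_total. rewrite (total_winding_swap _ (zadd (0, 1)%Z (1, 0)%Z) (0, 1)%Z).
  unfold Rminus. rewrite Ropp_involutive.
  change (total_winding (0, 0)%Z (1, 0)%Z (1, 1)%Z r +
          total_winding (0, 0)%Z (1, 1)%Z (0, 1)%Z r = 1).
  destruct (is_sum_add _ _ _ _ (total_winding_is_sum (0, 0)%Z (1, 0)%Z (1, 1)%Z r)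
    (total_winding_is_sum (0, 0)%Z (1, 1)%Z (0, 1)%Z r)) as (L & HL & HsL & <-).
  set (G := fun i => bond_winding (0, 0)%Z (1, 0)%Z (1, 1)%Z r i +
                     bond_winding (0, 0)%Z (1, 1)%Z (0, 1)%Z r i) in *.
  assert (HG : forall i, is_RInt (fun l =>
    (half_sg (fst (bond_pt i r l)) - half_sg (fst (bond_pt i r l) - 1)) *
    (half_sg (snd (bond_pt i r l)) - half_sg (snd (bond_pt i r l) - 1))) 0 1 (G i)).
  { intros i. apply is_RInt_ext_open with (fun l =>
      winding (0, 0)%Z (1, 0)%Z (1, 1)%Z (bond_pt i r l) +
      winding (0, 0)%Z (1, 1)%Z (0, 1)%Z (bond_pt i r l)); [lra | |].
    - intros l _. apply unit_square_winding.
    - apply is_RInt_add; apply bond_winding_is_RInt. }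
  (* The margin 2 makes every bond that starts outside the box miss the unit square, and keeps the
     displacement along a bond strictly below [N], as [half_sg_sum] requires. *)
  set (N := Z.to_nat (znorm r + 2)).
  destruct (znorm_R r (znorm r)) as [R1 R2]; [lia |].
  assert (HN : INR N = IZR (znorm r) + 2).
  { unfold N. rewrite INR_IZR_INZ, Z2Nat.id, plus_IZR; [reflexivity | unfold znorm; lia]. }
  assert (Hz : forall (a b : Z) l, Rabs (IZR a) <= IZR (znorm r) -> 0 < l < 1 ->
    ~ (Z.abs b <= Z.of_nat N)%Z ->
    half_sg (IZR a * l + IZR b) - half_sg (IZR a * l + IZR b - 1) = 0).
  { intros a b l Ha Hl Hb.
    assert (Hb' : INR N < Rabs (IZR b)).
    { rewrite INR_IZR_INZ, <- abs_IZR. apply IZR_lt. lia. }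
    rewrite HN in Hb'. unfold half_sg.
    assert (IZR a * l + IZR b < 0 \/ 1 < IZR a * l + IZR b).
    { revert Ha Hb'. unfold Rabs. repeat destruct Rcase_abs; intros; [left | right | left | right]; nra. }
    destruct H; [rewrite !sg_neg by lra | rewrite !sg_pos by lra]; lra. }
  rewrite (sum_list_support G L (zbox N)); [| exact HL | apply zbox_NoDup | exact HsL |].
  (* The finite sum is exchanged with the integral and the integral is evaluated twice: for each [l]
     the lattice translates of the square cover the point with total weight 1. *)
  - apply (is_RInt_det (fun l => sum_list (fun i =>
      (half_sg (fst (bond_pt i r l)) - half_sg (fst (bond_pt i r l) - 1)) *
      (half_sg (snd (bond_pt i r l)) - half_sg (snd (bond_pt i r l) - 1))) (zbox N)) 0 1).
    + apply is_RInt_sum_list. intros i _. apply HG.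
    + apply is_RInt_ext_open with (fun _ => 1); [lra | |].
      * intros l Hl.
        rewrite (sum_list_ext _ (fun i =>
          (half_sg (IZR (fst r) * l + IZR (fst i)) - half_sg (IZR (fst r) * l + IZR (fst i) - 1)) *
          (half_sg (IZR (snd r) * l + IZR (snd i)) - half_sg (IZR (snd r) * l + IZR (snd i) - 1)))).
        -- unfold zbox. rewrite (sum_list_prod_mult
             (fun a => half_sg (IZR (fst r) * l + IZR a) - half_sg (IZR (fst r) * l + IZR a - 1))
             (fun a => half_sg (IZR (snd r) * l + IZR a) - half_sg (IZR (snd r) * l + IZR a - 1))).
           rewrite !half_sg_sum; [ring | |];
             rewrite HN, Rabs_mult, (Rabs_pos_eq l) by lra;
             [pose proof (Rabs_pos (IZR (snd r))) | pose proof (Rabs_pos (IZR (fst r)))]; nra.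
        -- intros i _. now rewrite !bond_pt_eq.
      * apply is_RInt_eq with ((1 - 0) * 1); [apply is_RInt_cst | ring].
  - intros i Hi. apply NNPP. intros Hn. apply Hi.
    apply (is_RInt_det _ 0 1 _ _ (HG i)).
    apply is_RInt_ext_open with (fun _ => 0); [lra | | apply is_RInt_zero].
    intros l Hl. rewrite bond_pt_eq. simpl.
    destruct (Z_le_dec (Z.abs (fst i)) (Z.of_nat N)) as [H1 | H1].
    + rewrite (Hz (snd r) (snd i)); [ring | exact R2 | exact Hl |].
      intros H2. apply Hn. now apply zbox_In.
    + rewrite (Hz (fst r) (fst i)); [ring | exact R1 | exact Hl | exact H1].
Qed.

(** With [A] moved to the origin the two steps are B-A and C-B, and det(B-A, C-B) = det(B-A,
    C-A). *)
Lemma total_winding_det A B C r :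
  total_winding A B C r = tri_det (A, B, C) / 2.
Proof.
  rewrite <- (total_winding_translate A B C (zneg A)).
  replace (zadd A (zneg A)) with (0, 0)%Z by (unfold zneg; zpt_ring).
  replace (zadd C (zneg A)) with (zadd (zadd B (zneg A)) (zadd C (zneg B))) by zpt_ring.
  change (step_winding_total r (zadd B (zneg A)) (zadd C (zneg B)) = tri_det (A, B, C) / 2).
  rewrite step_winding_total_det, step_winding_total_unit.
  unfold tri_det, zadd, zneg, inj, tA, tB, tC. simpl.
  rewrite minus_IZR, !mult_IZR, !plus_IZR, !opp_IZR. field.
Qed.

(** * Barycentric coordinates and the winding number as density of a triangle *)

Definition orient (T : tri) : Z := sg (tri_det T).
(** Barycentric coordinates multiplied by [Rabs (tri_det T)]; the factor [orient T] makes them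
    positive inside the triangle for either order of the vertices. *)
Definition bary_a (T : tri) (x : pt) : R := IZR (orient T) * cr (tB T) (tC T) x.
Definition bary_b (T : tri) (x : pt) : R := IZR (orient T) * cr (tC T) (tA T) x.
Definition bary_c (T : tri) (x : pt) : R := IZR (orient T) * cr (tA T) (tB T) x.
Definition tri_weight (T : tri) (x : pt) : R := IZR (orient T) * winding (tA T) (tB T) (tC T) x.

Lemma orient_cases T : tri_det T <> 0 ->
  (tri_det T < 0 /\ orient T = (-1)%Z) \/ (0 < tri_det T /\ orient T = 1%Z).
Proof. intros H. unfold orient. destruct (sg_spec (tri_det T)) as [|[[E _]|]]; auto; lra. Qed.

Lemma orient_det T : IZR (orient T) * tri_det T = Rabs (tri_det T).
Proof.
  unfold orient. destruct (sg_spec (tri_det T)) as [[H ->]|[[H ->]|[H ->]]].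
  - rewrite Rabs_left; lra.
  - rewrite H, Rabs_R0. lra.
  - rewrite Rabs_pos_eq; lra.
Qed.

Lemma bary_sum T x : bary_a T x + bary_b T x + bary_c T x = Rabs (tri_det T).
Proof.
  rewrite <- orient_det. unfold bary_a, bary_b, bary_c, cr, tri_det, inj. simpl. ring.
Qed.

Definition tri_bond_weight (T : tri) (r i : zpt) : R :=
  IZR (orient T) * bond_winding (tA T) (tB T) (tC T) r i.

Lemma tri_bond_weight_is_RInt T r i :
  is_RInt (fun l => tri_weight T (bond_pt i r l)) 0 1 (tri_bond_weight T r i).
Proof. apply is_RInt_mult_l, bond_winding_is_RInt. Qed.

Lemma bond_density T r : is_sum (tri_bond_weight T r) (tri_area T).
Proof.
  replace (tri_area T) with (IZR (orient T) * total_winding (tA T) (tB T) (tC T) r).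
  - apply is_sum_mult_l, total_winding_is_sum.
  - unfold tri_area. rewrite total_winding_det, <- orient_det. destruct T as [[A B] C].
    unfold tA, tB, tC. simpl. field.
Qed.

Lemma sg_orient T x : tri_det T <> 0 -> sg (IZR (orient T) * x) = (orient T * sg x)%Z.
Proof.
  intros H. destruct (orient_cases T H) as [[_ ->]|[_ ->]]; rewrite sg_mult.
  - now rewrite (sg_neg (-1)) by lra.
  - now rewrite (sg_pos 1) by lra.
Qed.

(** Identifies the weight with the density of [T] outside, inside and on an open edge. Signs with
    sum 2 mean one coordinate zero and two positive; vertices are left out. *)
Lemma tri_weight_cases T x : tri_det T <> 0 ->
  (bary_a T x < 0 \/ bary_b T x < 0 \/ bary_c T x < 0 -> tri_weight T x = 0) /\
  (0 < bary_a T x -> 0 < bary_b T x -> 0 < bary_c T x -> tri_weight T x = 1) /\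
  ((sg (bary_a T x) + sg (bary_b T x) + sg (bary_c T x))%Z = 2%Z -> tri_weight T x = 1 / 2).
Proof.
  intros HT.
  set (a := IZR (fst (tA T)) - fst x). set (b := IZR (fst (tB T)) - fst x).
  set (c := IZR (fst (tC T)) - fst x).
  assert (HS : tri_weight T x = IZR (winding_signs (sg a) (sg b) (sg c)
    (sg (bary_a T x)) (sg (bary_b T x)) (sg (bary_c T x))) / 4).
  { unfold bary_a, bary_b, bary_c. rewrite !sg_orient by exact HT.
    unfold tri_weight, winding, winding_signs, edge_winding.
    fold a b c. rewrite !plus_IZR, !mult_IZR. field. }
  assert (Hn : ~ (sg a = 0 /\ sg b = 0 /\ sg c = 0)%Z).
  { intros (E1 & E2 & E3). apply HT.
    assert (Z0 : forall t, sg t = 0%Z -> t = 0)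
      by (intros t; destruct (sg_spec t) as [[? ->]|[[? ->]|[? ->]]]; intros; easy).
    apply Z0 in E1, E2, E3. unfold a, b, c in *. unfold tri_det, inj; simpl.
    replace (IZR (fst (tB T))) with (fst x) by lra.
    replace (IZR (fst (tC T))) with (fst x) by lra.
    replace (IZR (fst (tA T))) with (fst x) by lra. ring. }
  assert (H1 : ~ one_signed (sg (bary_a T x) * sg a) (sg (bary_b T x) * sg b) (sg (bary_c T x) * sg c)).
  { rewrite <- !sg_mult. apply one_signed_sg. unfold bary_a, bary_b, bary_c, cr, a, b, c. ring. }
  destruct (winding_signs_cases _ _ _ _ _ _ (sg_is_sign a) (sg_is_sign b) (sg_is_sign c)
    (sg_is_sign (bary_a T x)) (sg_is_sign (bary_b T x)) (sg_is_sign (bary_c T x)) H1)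
    as (W0 & W4 & W2).
  split; [| split].
  (* The coordinates have a positive sum, so next to a negative one there is a positive one, and the
     signs are mixed. *)
  - intros H. rewrite HS, W0; [lra |]. assert (S := bary_sum T x).
    assert (D := Rabs_pos_lt _ HT). unfold one_signed.
    destruct (sg_spec (bary_a T x)) as [[? ->]|[[? ->]|[? ->]]],
      (sg_spec (bary_b T x)) as [[? ->]|[[? ->]|[? ->]]],
      (sg_spec (bary_c T x)) as [[? ->]|[[? ->]|[? ->]]]; try lia; exfalso; lra.
  - intros. rewrite HS, W4; [lra | exact Hn | now apply sg_pos ..].
  - intros. rewrite HS, W2; [lra | exact Hn | assumption].
Qed.

(** * Areas of discs and half-discs, and the density [chi] *)

Lemma indic_true (P : Prop) : P -> indic P = 1.
Proof. unfold indic. destruct excluded_middle_informative; tauto. Qed.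
Lemma indic_false (P : Prop) : ~ P -> indic P = 0.
Proof. unfold indic. destruct excluded_middle_informative; tauto. Qed.

Lemma is_RInt_indic_interval (P : R -> Prop) (a l h b : R) : a <= l -> l <= h -> h <= b ->
  (forall t, t <> l -> t <> h -> (P t <-> l < t < h)) ->
  is_RInt (fun t => indic (P t)) a b (h - l).
Proof.
  intros Hal Hlh Hhb HP.
  apply is_RInt_ext_off_list with [l; h] (fun t => indic (l < t < h)); [lra | |].
  - intros t _ Hn. simpl in Hn. unfold indic.
    assert (H : P t <-> l < t < h) by (apply HP; intros ->; tauto).
    destruct excluded_middle_informative, excluded_middle_informative; tauto.
  - apply is_RInt_eq with (0 + ((h - l) * 1 + 0)); [| ring].
    apply is_RInt_join with l; [| apply is_RInt_join with h].
    + apply is_RInt_ext_open with (fun _ => 0); [lra | | apply is_RInt_zero].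
      intros t Ht. rewrite indic_false; lra.
    + apply is_RInt_ext_open with (fun _ => 1); [lra | | apply is_RInt_cst].
      intros t Ht. rewrite indic_true; lra.
    + apply is_RInt_ext_open with (fun _ => 0); [lra | | apply is_RInt_zero].
      intros t Ht. rewrite indic_false; lra.
Qed.

Definition half_chord (rho u : R) : R := sqrt (rho ^ 2 - u ^ 2).

Lemma continuous_half_chord rho u : continuous (half_chord rho) u.
Proof.
  apply continuous_sqrt_comp with (f := fun u => rho ^ 2 - u ^ 2).
  apply (ex_derive_continuous (fun u => rho ^ 2 - u ^ 2)). auto_derive. exact I.
Qed.

Lemma half_chord_spec rho u : 0 < rho -> Rabs u < rho ->
  0 < half_chord rho u /\ half_chord rho u ^ 2 = rho ^ 2 - u ^ 2.
Proof.
  intros Hr Hu. apply Rabs_def2 in Hu. assert (0 < rho ^ 2 - u ^ 2) by nra.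
  split; [now apply sqrt_lt_R0 |]. unfold half_chord. apply pow2_sqrt. lra.
Qed.

(** The substitution u = rho sin t turns the integrand into rho^2 cos^2 t, with primitive rho^2 (t +
    sin t cos t) / 2. *)
Lemma half_chord_integral rho : 0 < rho -> is_RInt (half_chord rho) (- rho) rho (PI * rho ^ 2 / 2).
Proof.
  intros Hr. assert (HPI := PI_RGT_0).
  assert (Hc := is_RInt_comp (V := R_CompleteNormedModule) (half_chord rho)
    (fun t => rho * sin t) (fun t => rho * cos t) (- (PI / 2)) (PI / 2)).
  cbv beta in Hc. rewrite sin_neg, sin_PI2 in Hc. rewrite !Rmult_1_r in Hc.
  replace (rho * -(1)) with (- rho) in Hc by ring.
  assert (Hex : ex_RInt (half_chord rho) (- rho) rho).
  { apply (ex_RInt_continuous (V := R_CompleteNormedModule)).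
    intros z _. apply continuous_half_chord. }
  apply (RInt_correct (V := R_CompleteNormedModule)) in Hex.
  apply is_RInt_eq with (1 := Hex).
  assert (Hd : is_RInt (fun t => rho ^ 2 * cos t ^ 2) (- (PI / 2)) (PI / 2) (PI * rho ^ 2 / 2)).
  { apply is_RInt_eq with
      (rho ^ 2 * ((PI / 2 + sin (PI / 2) * cos (PI / 2)) / 2) -
       rho ^ 2 * ((- (PI / 2) + sin (- (PI / 2)) * cos (- (PI / 2))) / 2));
      [| rewrite cos_neg, cos_PI2; field].
    apply (is_RInt_derive (V := R_CompleteNormedModule)
      (fun t => rho ^ 2 * ((t + sin t * cos t) / 2)) (fun t => rho ^ 2 * cos t ^ 2)).
    - intros t _. auto_derive; [exact I |]. pose proof (sin2_cos2 t) as E. unfold Rsqr in E.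
      transitivity (rho ^ 2 * ((1 + (cos t * cos t - sin t * sin t)) / 2)); [field |].
      replace (sin t * sin t) with (1 - cos t * cos t) by lra. field.
    - intros t _. apply (ex_derive_continuous (fun t => rho ^ 2 * cos t ^ 2)).
      auto_derive. exact I. }
  assert (Hg : forall t, is_derive (fun t => rho * sin t) t (rho * cos t) /\
    continuous (fun t => rho * cos t) t).
  { intros t. split; [auto_derive; [exact I | ring] |].
    apply (ex_derive_continuous (fun t => rho * cos t)). auto_derive. exact I. }
  apply (is_RInt_det _ _ _ _ _
    (Hc (fun t _ => continuous_half_chord rho _) (fun t _ => Hg t))).
  apply is_RInt_ext_open with (3 := Hd); [lra |].
  intros t Ht. unfold scal; simpl; unfold mult; simpl. unfold half_chord.
  assert (Hcos : 0 < cos t) by (apply cos_gt_0; lra).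
  replace (rho ^ 2 - (rho * sin t) ^ 2) with (Rsqr (rho * cos t)).
  - rewrite sqrt_Rsqr by nra. ring.
  - pose proof (sin2_cos2 t) as E. unfold Rsqr in *.
    replace (rho ^ 2 - (rho * sin t) ^ 2) with (rho * rho * (1 - sin t * sin t)) by ring.
    rewrite <- E. ring.
Qed.

Lemma is_RInt_odd (k : R -> R) rho : 0 <= rho -> ex_RInt k (- rho) rho ->
  (forall u, k (- u) = - k u) -> is_RInt k (- rho) rho 0.
Proof.
  intros Hr [v Hv] Hodd.
  assert (H : is_RInt k (- - rho) (- rho) (- v)).
  { rewrite Ropp_involutive. exact (is_RInt_swap (V := R_NormedModule) k rho (- rho) v Hv). }
  apply (is_RInt_comp_opp (V := R_NormedModule)) in H.
  assert (E : v = - v).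
  { apply (is_RInt_det k (- rho) rho); [exact Hv |].
    apply is_RInt_ext_open with (3 := H); [lra |].
    intros u _. unfold opp; simpl. rewrite Hodd. ring. }
  apply is_RInt_eq with v; [exact Hv | lra].
Qed.

(** For [q >= 0], the projection of [z] to the interval from [-q] to [q], written with absolute
    values so that oddness and continuity are immediate. *)
Definition clamp (q z : R) : R := (Rabs (z + q) - Rabs (z - q)) / 2.

Lemma clamp_spec q z : 0 <= q ->
  (z <= - q /\ clamp q z = - q) \/ (- q <= z <= q /\ clamp q z = z) \/ (q <= z /\ clamp q z = q).
Proof.
  intros Hq. unfold clamp, Rabs. repeat destruct Rcase_abs; [left | | right; left | right; right];
    try (split; lra); right; left; lra.
Qed.

Lemma clamp_opp q z : clamp q (- z) = - clamp q z.
Proof.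
  unfold clamp. rewrite <- (Rabs_Ropp (- z + q)), <- (Rabs_Ropp (- z - q)).
  replace (- (- z + q)) with (z - q) by ring. replace (- (- z - q)) with (z + q) by ring. field.
Qed.

Lemma ex_RInt_clamp rho m a b : ex_RInt (fun u => clamp (half_chord rho u) (m * u)) a b.
Proof.
  apply (ex_RInt_continuous (V := R_CompleteNormedModule)). intros z _.
  assert (Hm : continuous (fun u : R => m * u) z).
  { apply (ex_derive_continuous (fun u => m * u)). auto_derive. exact I. }
  unfold clamp.
  apply continuous_ext with
    (fun u => scal (/ 2) (minus (Rabs (plus (m * u) (half_chord rho u)))
                                (Rabs (minus (m * u) (half_chord rho u))))).
  - intros u. unfold scal, minus, plus, opp; simpl; unfold mult; simpl. unfold Rminus, Rdiv. ring.
  - apply (continuous_scal_r (K := R_AbsRing) (V := R_NormedModule)).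
    apply (continuous_minus (K := R_AbsRing) (V := R_NormedModule)); apply continuous_Rabs_comp.
    + apply (continuous_plus (K := R_AbsRing) (V := R_NormedModule)); [exact Hm |].
      apply continuous_half_chord.
    + apply (continuous_minus (K := R_AbsRing) (V := R_NormedModule)); [exact Hm |].
      apply continuous_half_chord.
Qed.

Lemma is_RInt_shift (f : R -> R) a b c v :
  is_RInt (fun u => f (c + u)) a b v -> is_RInt f (c + a) (c + b) v.
Proof.
  intros H. assert (H' : is_RInt (fun u => f (c + u)) (1 * (c + a) + - c) (1 * (c + b) + - c) v).
  { replace (1 * (c + a) + - c) with a by ring. now replace (1 * (c + b) + - c) with b by ring. }
  apply (is_RInt_comp_lin (V := R_NormedModule)) in H'.
  apply (is_RInt_ext (V := R_NormedModule)) with (2 := H').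
  intros u _. unfold scal; simpl; unfold mult; simpl.
  rewrite Rmult_1_l. f_equal. ring.
Qed.

(** The section through the centre is exempt: if the boundary line of a half-disc is vertical, that
    section does not follow the formula of the others. *)
Lemma area_box_sections (S : pt -> Prop) (x : pt) (J : R -> R) rho w : 0 < rho ->
  (forall u, - rho < u < rho -> u <> 0 ->
     is_RInt (fun v => indic (S (fst x + u, snd x + v))) (- rho) rho (J u)) ->
  is_RInt J (- rho) rho w ->
  area_box S (fst x - rho) (fst x + rho) (snd x - rho) (snd x + rho) = w.
Proof.
  intros Hr Hin Hout. unfold area_box. apply RInt_unique.
  apply is_RInt_shift with (a := - rho).
  apply is_RInt_ext_off_list with [0] J; [lra | | exact Hout].
  intros u Hu Hn. symmetry. apply RInt_unique. apply is_RInt_shift with (a := - rho).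
  apply Hin; [exact Hu |]. intros ->. apply Hn. now left.
Qed.

Lemma p_dist_lt z x d : 0 < d ->
  (p_dist z x < d <-> (fst z - fst x) ^ 2 + (snd z - snd x) ^ 2 < d ^ 2).
Proof.
  intros Hd. unfold p_dist, pnorm, psub. simpl fst. simpl snd.
  set (s := (fst z - fst x) ^ 2 + (snd z - snd x) ^ 2).
  assert (Hs : 0 <= s) by (apply Rplus_le_le_0_compat; apply pow2_ge_0).
  assert (E := pow2_sqrt s Hs). assert (P := sqrt_pos s).
  split; intros H; [rewrite <- E; nra | apply Rnot_le_lt; intros C; nra].
Qed.

Lemma disc_chord x u v rho : 0 < rho -> - rho < u < rho ->
  (p_dist (fst x + u, snd x + v) x < rho <-> - half_chord rho u < v < half_chord rho u).
Proof.
  intros Hr Hu. rewrite p_dist_lt by exact Hr. simpl fst. simpl snd.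
  replace (fst x + u - fst x) with u by ring. replace (snd x + v - snd x) with v by ring.
  destruct (half_chord_spec rho u Hr) as [H1 H2]; [apply Rabs_def1; lra |].
  split; [intros H; split | intros [Ha Hb]]; nra.
Qed.

Lemma half_chord_le rho u : 0 < rho -> - rho < u < rho -> 0 < half_chord rho u <= rho.
Proof.
  intros Hr Hu. destruct (half_chord_spec rho u Hr) as [H1 H2]; [apply Rabs_def1; lra |]. nra.
Qed.

Lemma disc_area x rho : 0 < rho ->
  area_box (fun z => p_dist z x < rho) (fst x - rho) (fst x + rho) (snd x - rho) (snd x + rho)
  = PI * rho ^ 2.
Proof.
  intros Hr. apply area_box_sections with (fun u => 2 * half_chord rho u); [exact Hr | |].
  - intros u Hu _. destruct (half_chord_le rho u Hr Hu).
    apply is_RInt_eq with (half_chord rho u - - half_chord rho u); [| ring].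
    apply is_RInt_indic_interval; try lra. intros t _ _. now apply disc_chord.
  - apply is_RInt_eq with (2 * (PI * rho ^ 2 / 2)); [| field].
    now apply is_RInt_mult_l, half_chord_integral.
Qed.

(* Each section of the half-disc has length [half_chord rho u + k u] with [k] odd,
   so the integral over [u] is half the area of the disc. *)
Lemma half_disc_area x alpha beta rho : 0 < rho -> alpha <> 0 \/ beta <> 0 ->
  area_box (fun z => 0 < alpha * (fst z - fst x) + beta * (snd z - snd x) /\ p_dist z x < rho)
    (fst x - rho) (fst x + rho) (snd x - rho) (snd x + rho) = PI * rho ^ 2 / 2.
Proof.
  intros Hr Hab.
  assert (Sec : exists k : R -> R, ex_RInt k (- rho) rho /\ (forall u, k (- u) = - k u) /\
    forall u, - rho < u < rho -> u <> 0 ->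
      is_RInt (fun v => indic (0 < alpha * u + beta * v /\ - half_chord rho u < v < half_chord rho u))
        (- rho) rho (half_chord rho u + k u)).
  { destruct (Req_dec beta 0) as [-> | Hb].
    (* Vertical boundary line: a section is the whole chord or empty, depending on the side. *)
    - exists (fun u => IZR (sg (alpha * u)) * half_chord rho u). split; [| split].
      + apply ex_RInt_Chasles with 0.
        * exists (RInt.RInt (fun u => IZR (- sg alpha) * half_chord rho u) (- rho) 0).
          apply is_RInt_ext_open with (fun u => IZR (- sg alpha) * half_chord rho u); [lra | |].
          -- intros u Hu. rewrite sg_mult, (sg_neg u), mult_IZR, opp_IZR by lra. ring.
          -- apply (RInt_correct (V := R_CompleteNormedModule)).
             apply (ex_RInt_scal (V := R_NormedModule)).
             apply (ex_RInt_continuous (V := R_CompleteNormedModule)).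
             intros z _. apply continuous_half_chord.
        * exists (RInt.RInt (fun u => IZR (sg alpha) * half_chord rho u) 0 rho).
          apply is_RInt_ext_open with (fun u => IZR (sg alpha) * half_chord rho u); [lra | |].
          -- intros u Hu. rewrite sg_mult, (sg_pos u), mult_IZR by lra. ring.
          -- apply (RInt_correct (V := R_CompleteNormedModule)).
             apply (ex_RInt_scal (V := R_NormedModule)).
             apply (ex_RInt_continuous (V := R_CompleteNormedModule)).
             intros z _. apply continuous_half_chord.
      + intros u. unfold half_chord. replace (alpha * - u) with (- (alpha * u)) by ring.
        rewrite sg_opp, opp_IZR. replace ((- u) ^ 2) with (u ^ 2) by ring. ring.
      + intros u Hu Hu0. destruct (half_chord_le rho u Hr Hu).
        destruct Hab as [Ha | Hb]; [| now elim Hb].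
        destruct (sg_spec (alpha * u)) as [[E ->] | [[E ->] | [E ->]]].
        * apply is_RInt_eq with (half_chord rho u - half_chord rho u); [| lra].
          apply is_RInt_indic_interval; try lra; intros t _ _; split; intros; lra.
        * exfalso. apply Rmult_integral in E. tauto.
        * apply is_RInt_eq with (half_chord rho u - - half_chord rho u); [| lra].
          apply is_RInt_indic_interval; try lra; intros t _ _; split; intros; lra.
    (* The boundary line meets the vertical at [u] in height [- alpha / beta * u]; clamped to the
       chord, this is the end of the section. *)
    - exists (fun u => IZR (- sg beta) * clamp (half_chord rho u) (- alpha / beta * u)).
      split; [| split].
      + apply (ex_RInt_scal (V := R_NormedModule)), ex_RInt_clamp.
      + intros u. unfold half_chord. replace ((- u) ^ 2) with (u ^ 2) by ring.
        replace (- alpha / beta * - u) with (- (- alpha / beta * u)) by ring.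
        rewrite clamp_opp. ring.
      + intros u Hu _. destruct (half_chord_le rho u Hr Hu).
        set (z := - alpha / beta * u).
        assert (Ez : forall v, alpha * u + beta * v = beta * (v - z))
          by (intros; unfold z; field; exact Hb).
        destruct (sg_spec beta) as [[Sb ->] | [[Sb _] | [Sb ->]]]; [| contradiction |].
        * assert (El : forall v, 0 < alpha * u + beta * v <-> v < z)
            by (intros v; rewrite Ez; split; intros; nra).
          apply is_RInt_eq with (clamp (half_chord rho u) z - - half_chord rho u); [| simpl; ring].
          destruct (clamp_spec (half_chord rho u) z) as [[? ->]|[[? ->]|[? ->]]]; [lra | | |];
            apply is_RInt_indic_interval; try lra; intros t Ht1 Ht2; rewrite El; split; intros; lra.
        * assert (El : forall v, 0 < alpha * u + beta * v <-> z < v)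
            by (intros v; rewrite Ez; split; intros; nra).
          apply is_RInt_eq with (half_chord rho u - clamp (half_chord rho u) z); [| simpl; ring].
          destruct (clamp_spec (half_chord rho u) z) as [[? ->]|[[? ->]|[? ->]]]; [lra | | |];
            apply is_RInt_indic_interval; try lra; intros t Ht1 Ht2; rewrite El; split; intros; lra. }
  destruct Sec as (k & Hk & Hodd & Hsec).
  apply area_box_sections with (fun u => half_chord rho u + k u); [exact Hr | |].
  - intros u Hu Hu0. apply is_RInt_ext_open with (3 := Hsec u Hu Hu0); [lra |].
    intros v _. f_equal. apply propositional_extensionality.
    rewrite disc_chord by assumption. simpl.
    replace (fst x + u - fst x) with u by ring. replace (snd x + v - snd x) with v by ring.
    reflexivity.
  - apply is_RInt_eq with (PI * rho ^ 2 / 2 + 0); [| ring].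
    apply is_RInt_add; [now apply half_chord_integral | apply is_RInt_odd; [lra | assumption ..]].
Qed.

(** * Values of [chi] outside, inside and along a straight boundary *)

Lemma area_box_empty (S : pt -> Prop) x rho : 0 < rho -> (forall z, ~ S z) ->
  area_box S (fst x - rho) (fst x + rho) (snd x - rho) (snd x + rho) = 0.
Proof.
  intros Hr HS. apply area_box_sections with (fun _ => 0); [exact Hr | | apply is_RInt_zero].
  intros u _ _. apply is_RInt_ext_open with (fun _ => 0); [lra | | apply is_RInt_zero].
  intros v _. symmetry. apply indic_false, HS.
Qed.

(** [chi] is some limit of the density picked by [epsilon]. If the density is constant for small
    radii, a limit exists, and any other value is refuted at one small radius. *)
Lemma chi_eventually (S : pt -> Prop) x l d : 0 < d ->
  (forall rho, 0 < rho < d -> density S x rho = l) -> chi S x = l.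
Proof.
  intros Hd H.
  assert (Hl : forall e, 0 < e -> exists d, 0 < d /\
    forall rho, 0 < rho < d -> Rabs (density S x rho - l) < e).
  { intros e He. exists d. split; [exact Hd |]. intros rho Hrho.
    rewrite (H rho Hrho), Rminus_diag. now rewrite Rabs_R0. }
  assert (Hc := epsilon_spec (inhabits 0) (fun l => forall e, 0 < e -> exists d, 0 < d /\
    forall rho, 0 < rho < d -> Rabs (density S x rho - l) < e) (ex_intro _ l Hl)).
  cbv beta in Hc. fold (chi S x) in Hc.
  destruct (Req_dec (chi S x) l) as [E | E]; [exact E | exfalso].
  destruct (Hc (Rabs (l - chi S x))) as (d' & Hd' & H'); [apply Rabs_pos_lt; lra |].
  assert (Hm : 0 < Rmin d d') by now apply Rmin_pos.
  assert (Rmin d d' <= d) by apply Rmin_l. assert (Rmin d d' <= d') by apply Rmin_r.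
  specialize (H' (Rmin d d' / 2)). rewrite H in H' by lra. lra.
Qed.

Lemma density_eq (S S' : pt -> Prop) x rho :
  (forall z, p_dist z x < rho -> (S z <-> S' z)) ->
  density S x rho = area_box (fun z => S' z /\ p_dist z x < rho)
    (fst x - rho) (fst x + rho) (snd x - rho) (snd x + rho) / (PI * rho ^ 2).
Proof.
  intros H. unfold density. do 2 f_equal. extensionality z.
  apply propositional_extensionality. specialize (H z). tauto.
Qed.

Lemma disc_area_pos rho : 0 < rho -> 0 < PI * rho ^ 2.
Proof. intros Hr. apply Rmult_lt_0_compat; [apply PI_RGT_0 | now apply pow_lt]. Qed.

Lemma chi_exterior (S : pt -> Prop) x d : 0 < d ->
  (forall z, p_dist z x < d -> ~ S z) -> chi S x = 0.
Proof.
  intros Hd H. apply chi_eventually with d; [exact Hd |]. intros rho Hrho.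
  unfold density. rewrite area_box_empty; [unfold Rdiv; ring | lra |].
  intros z [Hz Hz']. apply (H z); [lra | exact Hz].
Qed.

Lemma chi_inner (S : pt -> Prop) x d : 0 < d ->
  (forall z, p_dist z x < d -> S z) -> chi S x = 1.
Proof.
  intros Hd H. apply chi_eventually with d; [exact Hd |]. intros rho Hrho.
  unfold density.
  replace (fun z => S z /\ p_dist z x < rho) with (fun z => p_dist z x < rho).
  - rewrite disc_area by lra. pose proof (disc_area_pos rho ltac:(lra)). field.
    split; [lra | apply PI_neq0].
  - extensionality z. apply propositional_extensionality. split; [| tauto].
    intros Hz. split; [apply H; lra | exact Hz].
Qed.

Lemma chi_half_plane (S : pt -> Prop) x alpha beta d : 0 < d -> alpha <> 0 \/ beta <> 0 ->
  (forall z, p_dist z x < d ->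
     (S z <-> 0 < alpha * (fst z - fst x) + beta * (snd z - snd x))) -> chi S x = 1 / 2.
Proof.
  intros Hd Hab H. apply chi_eventually with d; [exact Hd |]. intros rho Hrho.
  rewrite (density_eq S (fun z => 0 < alpha * (fst z - fst x) + beta * (snd z - snd x))).
  - rewrite half_disc_area; [| lra | exact Hab].
    pose proof (disc_area_pos rho ltac:(lra)). field. split; [lra | apply PI_neq0].
  - intros z Hz. apply H. lra.
Qed.

(** * Triangles near a point of a bond *)

Lemma p_dist_refl x : p_dist x x = 0.
Proof.
  unfold p_dist, pnorm, psub. simpl. rewrite !Rminus_diag.
  replace (0 * (0 * 1) + 0 * (0 * 1)) with 0 by ring. apply sqrt_0.
Qed.

Lemma p_dist_triangle x z w : p_dist x w <= p_dist x z + p_dist z w.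
Proof.
  assert (E : forall a b, p_dist a b = dist_euc (fst a) (snd a) (fst b) (snd b)).
  { intros a b. unfold p_dist, pnorm, psub, dist_euc. simpl. f_equal. unfold Rsqr. ring. }
  rewrite !E. apply triangle.
Qed.

Lemma p_interior_self S x : p_interior S x -> S x.
Proof. intros (d & Hd & H). apply H. now rewrite p_dist_refl. Qed.

Lemma p_interior_mono (S S' : pt -> Prop) x :
  (forall z, S z -> S' z) -> p_interior S x -> p_interior S' x.
Proof. intros HS (d & Hd & H). exists d. auto. Qed.

(** [p_interior S x] serves from here on as the assertion that [S] holds near [x]; finite
    conjunctions preserve it. *)
Lemma p_interior_and (S S' : pt -> Prop) x :
  p_interior S x -> p_interior S' x -> p_interior (fun z => S z /\ S' z) x.
Proof.
  intros (d & Hd & H) (d' & Hd' & H'). exists (Rmin d d'). split; [now apply Rmin_pos |].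
  pose proof (Rmin_l d d'). pose proof (Rmin_r d d').
  intros z Hz. split; [apply H | apply H']; lra.
Qed.

Lemma p_interior_list {A} (S : A -> pt -> Prop) l x :
  (forall a, In a l -> p_interior (S a) x) -> p_interior (fun z => forall a, In a l -> S a z) x.
Proof.
  induction l as [| a l IH]; intros H.
  - exists 1. split; [lra | intros z _ a []].
  - apply p_interior_mono with (fun z => S a z /\ forall a, In a l -> S a z).
    + intros z [Ha Hl] b [<- | Hb]; auto.
    + apply p_interior_and; [apply H; now left | apply IH; intros; apply H; now right].
Qed.

Lemma p_interior_idem S x : p_interior S x -> p_interior (p_interior S) x.
Proof.
  intros (d & Hd & H). exists (d / 2). split; [lra |]. intros z Hz.
  exists (d / 2). split; [lra |]. intros w Hw. apply H.
  pose proof (p_dist_triangle w z x). lra.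
Qed.

Lemma p_interior_line S x v : p_interior S x ->
  exists d, 0 < d /\ forall h, Rabs h < d -> S (padd x (pscal h v)).
Proof.
  intros (d & Hd & H).
  set (k := pnorm v + 1).
  assert (Hk : 0 < k).
  { unfold k, pnorm. pose proof (sqrt_pos (fst v ^ 2 + snd v ^ 2)). lra. }
  exists (d / k). split; [now apply Rdiv_lt_0_compat |].
  intros h Hh. apply H.
  assert (E : p_dist (padd x (pscal h v)) x = Rabs h * pnorm v).
  { unfold p_dist, pnorm, psub, padd, pscal. cbn [fst snd].
    replace ((fst x + h * fst v - fst x) ^ 2 + (snd x + h * snd v - snd x) ^ 2)
      with (Rsqr h * (fst v ^ 2 + snd v ^ 2)) by (unfold Rsqr; ring).
    rewrite sqrt_mult_alt by apply Rle_0_sqr. now rewrite sqrt_Rsqr_abs. }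
  rewrite E. apply (Rmult_lt_compat_r k) in Hh; [| exact Hk].
  replace (d / k * k) with d in Hh by (field; lra).
  pose proof (Rabs_pos h). unfold k in *. nra.
Qed.

Lemma coord_le_dist z x : Rabs (fst z - fst x) <= p_dist z x /\ Rabs (snd z - snd x) <= p_dist z x.
Proof.
  unfold p_dist, pnorm, psub. cbn [fst snd]. split; rewrite <- sqrt_Rsqr_abs;
    apply sqrt_le_1_alt; unfold Rsqr;
    [pose proof (pow2_ge_0 (snd z - snd x)) | pose proof (pow2_ge_0 (fst z - fst x))]; nra.
Qed.

Lemma affine_pos_near (g : pt -> R) alpha beta x :
  (forall z, g z = g x + (alpha * (fst z - fst x) + beta * (snd z - snd x))) ->
  0 < g x -> p_interior (fun z => 0 < g z) x.
Proof.
  intros Hg Hx. set (k := Rabs alpha + Rabs beta + 1).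
  pose proof (Rabs_pos alpha). pose proof (Rabs_pos beta).
  assert (Hk : 0 < k) by (unfold k; lra).
  exists (g x / k). split; [now apply Rdiv_lt_0_compat |]. intros z Hz.
  rewrite Hg. destruct (coord_le_dist z x) as [H1 H2].
  apply (Rmult_lt_compat_r k) in Hz; [| exact Hk].
  replace (g x / k * k) with (g x) in Hz by (field; lra).
  set (d := p_dist z x) in *.
  assert (M1 : Rabs (alpha * (fst z - fst x)) <= Rabs alpha * d)
    by (rewrite Rabs_mult; now apply Rmult_le_compat_l).
  assert (M2 : Rabs (beta * (snd z - snd x)) <= Rabs beta * d)
    by (rewrite Rabs_mult; now apply Rmult_le_compat_l).
  assert (Hd : 0 <= d) by (pose proof (Rabs_pos (fst z - fst x)); lra).
  apply Rabs_le_between in M1, M2. unfold k in Hz. lra.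
Qed.

Lemma cr_affine P Q x z : cr P Q z = cr P Q x +
  ((IZR (snd P) - IZR (snd Q)) * (fst z - fst x) + (IZR (fst Q) - IZR (fst P)) * (snd z - snd x)).
Proof. unfold cr. ring. Qed.

(** The common form of [bary_a], [bary_b] and [bary_c], which are convertible to it, so that one
    argument covers all three edges. *)
Definition side (T : tri) (P Q : zpt) (x : pt) : R := IZR (orient T) * cr P Q x.

Lemma side_affine T P Q x z : side T P Q z = side T P Q x +
  (IZR (orient T) * (IZR (snd P) - IZR (snd Q)) * (fst z - fst x) +
   IZR (orient T) * (IZR (fst Q) - IZR (fst P)) * (snd z - snd x)).
Proof. unfold side. rewrite (cr_affine P Q x z). ring. Qed.

Lemma side_pos_near T P Q x : 0 < side T P Q x -> p_interior (fun z => 0 < side T P Q z) x.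
Proof. exact (affine_pos_near _ _ _ x (side_affine T P Q x)). Qed.

Lemma side_neg_near T P Q x : side T P Q x < 0 -> p_interior (fun z => side T P Q z < 0) x.
Proof.
  intros H. apply p_interior_mono with (fun z => 0 < - side T P Q z); [intros; lra |].
  apply affine_pos_near with (g := fun z => - side T P Q z)
    (alpha := - (IZR (orient T) * (IZR (snd P) - IZR (snd Q))))
    (beta := - (IZR (orient T) * (IZR (fst Q) - IZR (fst P)))); [| lra].
  intros z. rewrite (side_affine T P Q x z). ring.
Qed.

Lemma bary_of_coords T s t :
  let x := padd (inj (tA T)) (padd (pscal s (psub (inj (tB T)) (inj (tA T))))
                                   (pscal t (psub (inj (tC T)) (inj (tA T))))) in
  bary_a T x = Rabs (tri_det T) * (1 - s - t) /\ bary_b T x = Rabs (tri_det T) * s /\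
  bary_c T x = Rabs (tri_det T) * t.
Proof.
  rewrite <- orient_det. unfold bary_a, bary_b, bary_c, cr, tri_det, inj, padd, pscal, psub. simpl.
  repeat split; ring.
Qed.

Lemma coords_of_bary T x : tri_det T <> 0 ->
  x = padd (inj (tA T)) (padd (pscal (bary_b T x / Rabs (tri_det T)) (psub (inj (tB T)) (inj (tA T))))
                              (pscal (bary_c T x / Rabs (tri_det T)) (psub (inj (tC T)) (inj (tA T))))).
Proof.
  intros H.
  assert (E : forall u, IZR (orient T) * u / Rabs (tri_det T) = u / tri_det T).
  { intros u. rewrite <- orient_det. destruct (orient_cases T H) as [[_ ->]|[_ ->]]; field; exact H. }
  unfold bary_b, bary_c. rewrite !E. destruct x as [x1 x2].
  unfold cr, tri_det, inj, padd, pscal, psub in *. simpl in *. f_equal; field; exact H.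
Qed.

Lemma in_tri_bary T x : tri_det T <> 0 ->
  (in_tri T x <-> 0 <= bary_a T x /\ 0 <= bary_b T x /\ 0 <= bary_c T x).
Proof.
  intros H. assert (D := Rabs_pos_lt _ H). split.
  - intros (s & t & Hs & Ht & Hst & ->).
    destruct (bary_of_coords T s t) as (-> & -> & ->). repeat split; nra.
  - intros (Ha & Hb & Hc). exists (bary_b T x / Rabs (tri_det T)), (bary_c T x / Rabs (tri_det T)).
    assert (S := bary_sum T x). repeat split.
    + now apply Rdiv_le_0_compat.
    + now apply Rdiv_le_0_compat.
    + rewrite <- Rdiv_plus_distr. apply Rle_div_l; lra.
    + now apply coords_of_bary.
Qed.

Lemma in_tri_open_bary T x : tri_det T <> 0 ->
  (in_tri_open T x <-> 0 < bary_a T x /\ 0 < bary_b T x /\ 0 < bary_c T x).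
Proof.
  intros H. assert (D := Rabs_pos_lt _ H). split.
  - intros (s & t & Hs & Ht & Hst & ->).
    destruct (bary_of_coords T s t) as (-> & -> & ->). repeat split; nra.
  - intros (Ha & Hb & Hc). exists (bary_b T x / Rabs (tri_det T)), (bary_c T x / Rabs (tri_det T)).
    assert (S := bary_sum T x). repeat split.
    + now apply Rdiv_lt_0_compat.
    + now apply Rdiv_lt_0_compat.
    + rewrite <- Rdiv_plus_distr. apply Rlt_div_l; lra.
    + now apply coords_of_bary.
Qed.

Lemma in_tri_open_in_tri T x : in_tri_open T x -> in_tri T x.
Proof. intros (s & t & Hs & Ht & Hst & E). exists s, t. repeat split; lra || exact E. Qed.

Lemma in_tri_open_interior T x : tri_det T <> 0 -> in_tri_open T x -> p_interior (in_tri_open T) x.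
Proof.
  intros HT H. apply in_tri_open_bary in H as (Ha & Hb & Hc); [| exact HT].
  apply p_interior_mono with (fun z => (0 < bary_a T z /\ 0 < bary_b T z) /\ 0 < bary_c T z).
  - intros z H. apply in_tri_open_bary; tauto.
  - apply p_interior_and; [apply p_interior_and |]; now apply side_pos_near.
Qed.

Lemma centroid_open T : in_tri_open T (centroid T).
Proof.
  exists (1 / 3), (1 / 3). repeat split; try lra.
  unfold centroid, padd, pscal, psub, inj. simpl. f_equal; field.
Qed.

(** The signed distance of [z] from the line through [x] in direction [r], scaled by the length of
    [r]; its sign tells the side. *)
Definition rcross (r : zpt) (x z : pt) : R :=
  IZR (fst r) * (snd z - snd x) - IZR (snd r) * (fst z - fst x).

Lemma rcross_shift r x z k :
  rcross r x (padd z (pscal k (- IZR (snd r), IZR (fst r)))) =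
  rcross r x z + k * (IZR (fst r) ^ 2 + IZR (snd r) ^ 2).
Proof. unfold rcross, padd, pscal. simpl. ring. Qed.

Lemma rcross_along r x h : rcross r x (padd x (pscal h (inj r))) = 0.
Proof. unfold rcross, padd, pscal, inj. simpl. ring. Qed.

Lemma znonzero_sq r : r <> (0, 0)%Z -> 0 < IZR (fst r) ^ 2 + IZR (snd r) ^ 2.
Proof.
  destruct r as [a b]. simpl. intros H.
  destruct (Z.eq_dec a 0) as [-> | Ha].
  - assert (IZR b <> 0) by (apply not_0_IZR; congruence). nra.
  - assert (IZR a <> 0) by (apply not_0_IZR; exact Ha). nra.
Qed.

Lemma side_parallel T P Q r x : tri_det T <> 0 -> r <> (0, 0)%Z -> P <> Q ->
  side T P Q x = 0 -> cr_slope P Q r = 0 ->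
  exists mu, mu <> 0 /\ forall z, side T P Q z = mu * rcross r x z.
Proof.
  intros HT Hr HPQ Hx Hs.
  set (a := IZR (snd P) - IZR (snd Q)). set (b := IZR (fst Q) - IZR (fst P)).
  assert (Hab : a <> 0 \/ b <> 0).
  { apply NNPP. intros H. apply HPQ. assert (Ea : a = 0) by tauto. assert (Eb : b = 0) by tauto.
    apply zpt_ext; apply eq_IZR; unfold a, b in *; lra. }
  assert (Ho : IZR (orient T) <> 0).
  { destruct (orient_cases T HT) as [[_ ->] | [_ ->]]; lra. }
  assert (Hn := znonzero_sq r Hr). unfold cr_slope in Hs. fold b in Hs.
  replace (IZR (snd Q) - IZR (snd P)) with (- a) in Hs by (unfold a; ring).
  set (n := IZR (fst r) ^ 2 + IZR (snd r) ^ 2) in *.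
  (* The normal [(a, b)] of the edge is parallel to the normal [(- snd r, fst r)] of the bond; [k]
     is the coefficient of the projection. *)
  set (k := (b * IZR (fst r) - a * IZR (snd r)) / n).
  assert (Ea : a = k * - IZR (snd r)).
  { unfold k. apply (Rmult_eq_reg_r n); [| lra]. field_simplify; [| lra].
    unfold n. replace (IZR (snd r) * b) with (- (IZR (fst r) * a)) by lra.
    transitivity (a * IZR (snd r) ^ 2 - IZR (fst r) * (IZR (snd r) * b)); [| ring].
    replace (IZR (snd r) * b) with (- (IZR (fst r) * a)) by lra. ring. }
  assert (Eb : b = k * IZR (fst r)).
  { unfold k. apply (Rmult_eq_reg_r n); [| lra]. field_simplify; [| lra].
    unfold n.
    transitivity (b * IZR (fst r) ^ 2 - IZR (snd r) * (IZR (fst r) * a)); [| ring].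
    replace (IZR (fst r) * a) with (- (IZR (snd r) * b)) by lra. ring. }
  exists (IZR (orient T) * k). split.
  - intros H. apply Rmult_integral in H as [H | H]; [contradiction |].
    rewrite H in Ea, Eb. lra.
  - intros z. rewrite (side_affine T P Q x z), Hx. fold a b. rewrite Ea, Eb. unfold rcross. ring.
Qed.

(** The three pictures near a point of a bond, each tied to its weight: inside, outside, or on an
    edge parallel to [r], where [T] looks like a half-plane bounded by the line of the bond. The
    sign of [mu] tells on which side [T] lies. *)
Definition tri_local (T : tri) (r : zpt) (x : pt) : Prop :=
  (tri_weight T x = 1 /\ p_interior (in_tri_open T) x) \/
  (tri_weight T x = 0 /\ p_interior (fun z => ~ in_tri T z) x) \/
  (tri_weight T x = 1 / 2 /\ exists mu, mu <> 0 /\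
     p_interior (fun z => (in_tri T z <-> 0 <= mu * rcross r x z) /\
                          (in_tri_open T z <-> 0 < mu * rcross r x z)) x).

Lemma tri_det_vertices T : tri_det T <> 0 -> tA T <> tB T /\ tB T <> tC T /\ tC T <> tA T.
Proof.
  intros H. repeat split; intros E; apply H; unfold tri_det; rewrite E; ring.
Qed.

(** Cramer's rule: [r] times the determinant is a combination of the two slopes. *)
Lemma cr_slope_nonparallel P Q S r : tri_det (P, Q, S) <> 0 ->
  cr_slope P Q r = 0 -> cr_slope Q S r = 0 -> r = (0, 0)%Z.
Proof.
  intros H H1 H2.
  assert (E1 : IZR (fst r) * tri_det (P, Q, S) =
    (IZR (fst S) - IZR (fst Q)) * cr_slope P Q r - (IZR (fst Q) - IZR (fst P)) * cr_slope Q S r)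
    by (unfold cr_slope, tri_det, inj, tA, tB, tC; simpl; ring).
  assert (E2 : IZR (snd r) * tri_det (P, Q, S) =
    (IZR (snd S) - IZR (snd Q)) * cr_slope P Q r - (IZR (snd Q) - IZR (snd P)) * cr_slope Q S r)
    by (unfold cr_slope, tri_det, inj, tA, tB, tC; simpl; ring).
  rewrite H1, H2, !Rmult_0_r, Rminus_diag in E1, E2.
  apply Rmult_integral in E1, E2.
  apply zpt_ext; apply eq_IZR; simpl; tauto.
Qed.

(** Only edge lines parallel to [r] may pass through [x]. For nonzero [r] and a nondegenerate
    triangle this excludes the vertices, where two edge lines meet. *)
Definition generic (T : tri) (r : zpt) (x : pt) : Prop :=
  (cr (tB T) (tC T) x = 0 -> cr_slope (tB T) (tC T) r = 0) /\
  (cr (tC T) (tA T) x = 0 -> cr_slope (tC T) (tA T) r = 0) /\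
  (cr (tA T) (tB T) x = 0 -> cr_slope (tA T) (tB T) r = 0).

Lemma tri_local_generic T r x : tri_det T <> 0 -> r <> (0, 0)%Z -> generic T r x -> tri_local T r x.
Proof.
  intros HT Hr Hg.
  assert (Ho : IZR (orient T) <> 0).
  { destruct (orient_cases T HT) as [[_ ->] | [_ ->]]; lra. }
  assert (Z0 : forall P Q, side T P Q x = 0 -> cr P Q x = 0).
  { intros P Q H. unfold side in H. apply Rmult_integral in H. tauto. }
  destruct Hg as (Ga & Gb & Gc).
  assert (Ga' : bary_a T x = 0 -> cr_slope (tB T) (tC T) r = 0) by (intros H; now apply Ga, Z0).
  assert (Gb' : bary_b T x = 0 -> cr_slope (tC T) (tA T) r = 0) by (intros H; now apply Gb, Z0).
  assert (Gc' : bary_c T x = 0 -> cr_slope (tA T) (tB T) r = 0) by (intros H; now apply Gc, Z0).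
  destruct (tri_weight_cases T x HT) as (W0 & W1 & W2).
  destruct (tri_det_vertices T HT) as (NAB & NBC & NCA).
  assert (Hneg : bary_a T x < 0 \/ bary_b T x < 0 \/ bary_c T x < 0 -> tri_local T r x).
  { intros H. right. left. split; [now apply W0 |].
    destruct H as [H | [H | H]]; apply side_neg_near in H;
      (apply p_interior_mono with (2 := H); intros z Hz Hin;
       apply in_tri_bary in Hin; [| exact HT];
       unfold side, bary_a, bary_b, bary_c in *; lra). }
  assert (D1 : tri_det (tB T, tC T, tA T) <> 0).
  { intros E. apply HT. rewrite <- E. unfold tri_det, tA, tB, tC. simpl. ring. }
  assert (D2 : tri_det (tC T, tA T, tB T) <> 0).
  { intros E. apply HT. rewrite <- E. unfold tri_det, tA, tB, tC. simpl. ring. }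
  assert (D3 : tri_det (tA T, tB T, tC T) <> 0).
  { destruct T as [[A B] C]. exact HT. }
  destruct (Rlt_dec (bary_a T x) 0); [auto |].
  destruct (Rlt_dec (bary_b T x) 0); [auto |].
  destruct (Rlt_dec (bary_c T x) 0); [auto |].
  destruct (Req_dec (bary_a T x) 0) as [Ea | Ea]; [| destruct (Req_dec (bary_b T x) 0) as [Eb | Eb];
    [| destruct (Req_dec (bary_c T x) 0) as [Ec | Ec]]].
  (* A second vanishing coordinate would make two edges parallel to [r]. *)
  - assert (Pb : 0 < bary_b T x).
    { apply Rnot_le_lt. intros H. apply Hr, (cr_slope_nonparallel _ _ _ r D1); [auto | apply Gb'; lra]. }
    assert (Pc : 0 < bary_c T x).
    { apply Rnot_le_lt. intros H. apply Hr, (cr_slope_nonparallel _ _ _ r D3); [apply Gc'; lra | auto]. }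
    right. right. split; [apply W2; now rewrite Ea, sg_0, !sg_pos |].
    destruct (side_parallel T (tB T) (tC T) r x) as (mu & Hmu & E); auto.
    exists mu. split; [exact Hmu |].
    apply side_pos_near in Pb, Pc. apply p_interior_mono with (2 := p_interior_and _ _ _ Pb Pc).
    intros z [Hb Hc]. rewrite in_tri_bary, in_tri_open_bary, <- E by exact HT.
    change (0 < bary_b T z) in Hb. change (0 < bary_c T z) in Hc.
    change (side T (tB T) (tC T) z) with (bary_a T z). clear - Hb Hc. intuition lra.
  - assert (Pa : 0 < bary_a T x) by lra.
    assert (Pc : 0 < bary_c T x).
    { apply Rnot_le_lt. intros H. apply Hr, (cr_slope_nonparallel _ _ _ r D2); [auto | apply Gc'; lra]. }
    right. right. split; [apply W2; now rewrite Eb, sg_0, !sg_pos |].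
    destruct (side_parallel T (tC T) (tA T) r x) as (mu & Hmu & E); auto.
    exists mu. split; [exact Hmu |].
    apply side_pos_near in Pa, Pc. apply p_interior_mono with (2 := p_interior_and _ _ _ Pa Pc).
    intros z [Ha Hc]. rewrite in_tri_bary, in_tri_open_bary, <- E by exact HT.
    change (0 < bary_a T z) in Ha. change (0 < bary_c T z) in Hc.
    change (side T (tC T) (tA T) z) with (bary_b T z). clear - Ha Hc. intuition lra.
  - assert (Pa : 0 < bary_a T x) by lra. assert (Pb : 0 < bary_b T x) by lra.
    right. right. split; [apply W2; now rewrite Ec, sg_0, !sg_pos |].
    destruct (side_parallel T (tA T) (tB T) r x) as (mu & Hmu & E); auto.
    exists mu. split; [exact Hmu |].
    apply side_pos_near in Pa, Pb. apply p_interior_mono with (2 := p_interior_and _ _ _ Pa Pb).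
    intros z [Ha Hb]. rewrite in_tri_bary, in_tri_open_bary, <- E by exact HT.
    change (0 < bary_a T z) in Ha. change (0 < bary_b T z) in Hb.
    change (side T (tA T) (tB T) z) with (bary_c T z). clear - Ha Hb. intuition lra.
  - assert (Pa : 0 < bary_a T x) by lra. assert (Pb : 0 < bary_b T x) by lra.
    assert (Pc : 0 < bary_c T x) by lra.
    left. split; [now apply W1 |]. apply in_tri_open_interior; [exact HT |].
    now apply in_tri_open_bary.
Qed.

(** * The integrand of [c_b] *)

Lemma pnorm_pos v : v <> (0, 0) -> 0 < pnorm v.
Proof.
  destruct v as [a b]. intros H. apply sqrt_lt_R0. simpl.
  destruct (Req_dec a 0) as [-> | Ha]; [| nra].
  assert (b <> 0) by congruence. nra.
Qed.

Lemma Dr_eventually (y : pt -> pt) r x L d : 0 < d ->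
  (forall h, 0 < Rabs h < d -> pscal (/ h) (psub (y (padd x (pscal h r))) (y x)) = L) ->
  Dr y r x = L.
Proof.
  intros Hd H.
  assert (HL : forall e, 0 < e -> exists d, 0 < d /\ forall h, 0 < Rabs h < d ->
    pnorm (psub (pscal (/ h) (psub (y (padd x (pscal h r))) (y x))) L) < e).
  { intros e He. exists d. split; [exact Hd |]. intros h Hh. rewrite (H h Hh).
    fold (p_dist L L). now rewrite p_dist_refl. }
  assert (Hc := epsilon_spec (inhabits (0, 0)) (fun L => forall e, 0 < e -> exists d, 0 < d /\
    forall h, 0 < Rabs h < d ->
    pnorm (psub (pscal (/ h) (psub (y (padd x (pscal h r))) (y x))) L) < e) (ex_intro _ L HL)).
  cbv beta in Hc. fold (Dr y r x) in Hc.
  set (L' := Dr y r x) in *. clearbody L'. apply NNPP. intros Hne.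
  assert (Hp : 0 < pnorm (psub L L')).
  { apply pnorm_pos. intros E. apply Hne. unfold psub in E. injection E as E1 E2.
    destruct L, L'; simpl in *. f_equal; lra. }
  destruct (Hc _ Hp) as (d' & Hd' & H').
  assert (Hm : 0 < Rmin d d') by now apply Rmin_pos.
  assert (Rmin d d' <= d) by apply Rmin_l. assert (Rmin d d' <= d') by apply Rmin_r.
  specialize (H' (Rmin d d' / 2)). rewrite H in H' by (rewrite Rabs_pos_eq; lra).
  rewrite Rabs_pos_eq in H' by lra. assert (pnorm (psub L L') < pnorm (psub L L')) by (apply H'; lra).
  lra.
Qed.

(** A short segment through [x] in direction [r] inside the closed triangle makes the difference
    quotients constant. No full neighbourhood is asked for, so the result covers points on an edge
    parallel to [r]. *)
Lemma Dr_affine (y : pt -> pt) T r x : affine_on (in_tri T) y -> tri_det T <> 0 ->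
  (exists d, 0 < d /\ forall h, Rabs h < d -> in_tri T (padd x (pscal h r))) ->
  Dr y r x = Dr y r (centroid T).
Proof.
  intros (a11 & a12 & a21 & a22 & c1 & c2 & Hy) HT.
  assert (G : forall x, (exists d, 0 < d /\ forall h, Rabs h < d -> in_tri T (padd x (pscal h r))) ->
    Dr y r x = (a11 * fst r + a12 * snd r, a21 * fst r + a22 * snd r)).
  { clear x. intros x (d & Hd & H). apply Dr_eventually with d; [exact Hd |]. intros h Hh.
    assert (h <> 0) by (intros ->; rewrite Rabs_R0 in Hh; lra).
    assert (Hx : in_tri T x).
    { replace x with (padd x (pscal 0 r)); [apply H; rewrite Rabs_R0; exact Hd |].
      destruct x. unfold padd, pscal. simpl. f_equal; ring. }
    rewrite (Hy x Hx), (Hy _ (H h ltac:(lra))).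
    unfold padd, pscal, psub. simpl. f_equal; field; assumption. }
  intros Hx. rewrite (G x Hx). symmetry. apply G.
  destruct (p_interior_line _ _ r (in_tri_open_interior T _ HT (centroid_open T))) as (d & Hd & H).
  exists d. split; [exact Hd |]. intros h Hh. now apply in_tri_open_in_tri, H.
Qed.

Lemma tri_local_line T r x : tri_weight T x <> 0 -> tri_local T r x ->
  exists d, 0 < d /\ forall h, Rabs h < d -> in_tri T (padd x (pscal h (inj r))).
Proof.
  intros Hw [[_ H] | [[H _] | [_ (mu & _ & H)]]]; [| contradiction |];
    apply p_interior_line with (v := inj r) in H as (d & Hd & H);
    exists d; (split; [exact Hd |]); intros h Hh.
  - now apply in_tri_open_in_tri, H.
  - apply (H h Hh). rewrite rcross_along. lra.
Qed.

(** A small step along the normal of the bond, on the side given by the sign of [mu]. It moves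
    statements from the line of the bond to points strictly off it, where open triangles can be
    compared. *)
Lemma half_plane_point r x mu (Q : pt -> Prop) z : r <> (0, 0)%Z -> mu <> 0 -> p_interior Q z ->
  exists w, Q w /\ mu * rcross r x z < mu * rcross r x w.
Proof.
  intros Hr Hmu H.
  apply p_interior_line with (v := (- IZR (snd r), IZR (fst r))) in H as (d & Hd & H).
  assert (Hn := znonzero_sq r Hr).
  exists (padd z (pscal (IZR (sg mu) * (d / 2)) (- IZR (snd r), IZR (fst r)))).
  rewrite rcross_shift.
  set (n := IZR (fst r) ^ 2 + IZR (snd r) ^ 2) in *.
  assert (Hdn : 0 < d / 2 * n) by (apply Rmult_lt_0_compat; lra).
  destruct (sg_spec mu) as [[Hs ->] | [[Hs _] | [Hs ->]]]; [| contradiction |].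
  - split; [apply H; rewrite Rabs_left; lra | nra].
  - split; [apply H; rewrite Rabs_pos_eq; lra | nra].
Qed.

Lemma triangulation_disjoint LT T T' x : triangulation LT -> In T LT -> In T' LT -> T <> T' ->
  in_tri_open T x -> in_tri_open T' x -> False.
Proof.
  intros (_ & Hd & _) H H' Hne HT HT'.
  apply In_nth with (d := tri0) in H as (k & Hk & Ek), H' as (l & Hl & El).
  apply (Hd k l Hk Hl) with x; [intros -> ; congruence |]. now rewrite Ek, El.
Qed.

(** Interiors are disjoint by position in the list, so a triangle listed twice would contradict this
    at its own centroid. *)
Lemma triangulation_NoDup LT : triangulation LT -> NoDup LT.
Proof.
  intros (_ & Hd & _). apply (NoDup_nth LT tri0). intros k l Hk Hl E.
  destruct (Nat.eq_dec k l) as [| Hne]; [assumption | exfalso].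
  apply (Hd k l Hk Hl Hne (centroid (nth k LT tri0))).
  split; [| rewrite <- E]; apply centroid_open.
Qed.

(* Off finitely many points of a bond, [x] lies inside one triangle, or outside
   all of them, or on an edge parallel to [r] of one triangle or of two triangles
   lying on opposite sides of the bond. *)
Lemma bond_integrand (Oc : pt -> Prop) LT varphi y r x :
  triangulation LT ->
  (forall x, Oc x <-> p_interior (unionT LT) x) ->
  (forall T, In T LT -> affine_on (in_tri T) y) ->
  r <> (0, 0)%Z -> (forall T, In T LT -> generic T r x) ->
  (if excluded_middle_informative (chi Oc x = 0) then 0
   else chi Oc x * phi varphi (Dr y (inj r) x)) =
  sum_list (fun T => phi varphi (Dr y (inj r) (centroid T)) * tri_weight T x) LT.
Proof.
  intros Htri HOc Haff Hr Hgen.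
  assert (Hdet : forall T, In T LT -> tri_det T <> 0) by apply Htri.
  assert (Hnd := triangulation_NoDup LT Htri).
  assert (Hloc : forall T, In T LT -> tri_local T r x)
    by (intros; apply tri_local_generic; auto).
  assert (HDr : forall T, In T LT -> tri_weight T x <> 0 ->
    Dr y (inj r) x = Dr y (inj r) (centroid T)).
  { intros T HT Hw. apply Dr_affine; auto. exact (tri_local_line T r x Hw (Hloc T HT)). }
  assert (Hxx : rcross r x x = 0) by (unfold rcross; ring).
  destruct (classic (exists T, In T LT /\ p_interior (in_tri_open T) x)) as [(T & HT & HTi) | Hno].
  { assert (Hw : tri_weight T x = 1).
    { destruct (Hloc T HT) as [[H _] | [[_ H] | [_ (mu & Hmu & H)]]]; [exact H | exfalso | exfalso];
        apply p_interior_self in H, HTi.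
      - now apply H, in_tri_open_in_tri.
      - apply H in HTi. rewrite Hxx in HTi. lra. }
    assert (HO : p_interior Oc x).
    { apply p_interior_mono with (2 := p_interior_idem _ _ HTi).
      intros z Hz. apply HOc, p_interior_mono with (2 := Hz).
      intros w Hw'. exists T. split; [exact HT | now apply in_tri_open_in_tri]. }
    destruct HO as (d & Hd & HO). rewrite (chi_inner Oc x d Hd HO).
    destruct excluded_middle_informative; [lra |].
    rewrite (sum_list_single _ LT T Hnd HT).
    - rewrite Hw, (HDr T HT) by lra. ring.
    - intros T' HT' Hne.
      destruct (Hloc T' HT') as [[_ H] | [[-> _] | [_ (mu & Hmu & H)]]]; [exfalso | ring | exfalso].
      + apply p_interior_self in H, HTi. now apply (triangulation_disjoint LT T' T x).
      + destruct (half_plane_point r x mu _ x Hr Hmu (p_interior_and _ _ _ H HTi))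
          as (z & [[_ Hz] Hz'] & Hp).
        rewrite Hxx, Rmult_0_r in Hp.
        apply (triangulation_disjoint LT T' T z); auto. now apply Hz. }
  assert (Hhalf : forall T, In T LT -> tri_weight T x <> 0 -> tri_weight T x = 1 / 2 /\
    exists mu, mu <> 0 /\
     p_interior (fun z => (in_tri T z <-> 0 <= mu * rcross r x z) /\
                          (in_tri_open T z <-> 0 < mu * rcross r x z)) x).
  { intros T HT Hw. destruct (Hloc T HT) as [[_ H] | [[H _] | H]]; [| contradiction | exact H].
    exfalso. apply Hno. eauto. }
  assert (Hout : forall T, In T LT -> tri_weight T x = 0 -> p_interior (fun z => ~ in_tri T z) x).
  { intros T HT Hw. destruct (Hloc T HT) as [[H _] | [[_ H] | [H _]]]; [| exact H |];
      rewrite Hw in H; exfalso; lra. }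
  destruct (classic (exists T, In T LT /\ tri_weight T x <> 0)) as [(T & HT & Hw0) | Hall].
  (* A whole neighbourhood misses every triangle, so [chi] is 0 and the default value 0 of the
     integrand matches a sum of zeros. *)
  2: { assert (Hz : forall T, In T LT -> tri_weight T x = 0).
    { intros T HT. apply NNPP. intros H. apply Hall. eauto. }
    destruct (p_interior_list (fun T z => ~ in_tri T z) LT x) as (d & Hd & H); [auto |].
    rewrite (chi_exterior Oc x d Hd).
    - rewrite sum_list_zero; [now destruct excluded_middle_informative |].
      intros T HT. rewrite (Hz T HT). ring.
    - intros z Hzd HO. apply HOc, p_interior_self in HO as (T & HT & HzT).
      exact (H z Hzd T HT HzT). }
  destruct (Hhalf T HT Hw0) as (Hw & mu & Hmu & HI).
  (* Two triangles bordering the bond line at [x] lie on opposite sides of it, since otherwise a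
     point slightly off the line would be interior to both. So there are at most two of them. *)
  assert (Hopp : forall T1 T2 m1 m2, In T1 LT -> In T2 LT -> T1 <> T2 -> m1 <> 0 -> m2 <> 0 ->
    p_interior (fun z => (in_tri T1 z <-> 0 <= m1 * rcross r x z) /\
                         (in_tri_open T1 z <-> 0 < m1 * rcross r x z)) x ->
    p_interior (fun z => (in_tri T2 z <-> 0 <= m2 * rcross r x z) /\
                         (in_tri_open T2 z <-> 0 < m2 * rcross r x z)) x ->
    (0 < m1 /\ m2 < 0) \/ (m1 < 0 /\ 0 < m2)).
  { intros T1 T2 m1 m2 I1 I2 Hne Hm1 Hm2 H1 H2.
    destruct (half_plane_point r x m1 _ x Hr Hm1 (p_interior_and _ _ _ H1 H2))
      as (z & [[_ Hz1] [_ Hz2]] & Hp).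
    rewrite Hxx, Rmult_0_r in Hp.
    assert (Hn : ~ 0 < m2 * rcross r x z).
    { intros Hp2. apply (triangulation_disjoint LT T1 T2 z); tauto. }
    destruct (Rtotal_order m1 0) as [? | [? | ?]], (Rtotal_order m2 0) as [? | [? | ?]];
      try lra; exfalso; apply Hn; nra. }
  destruct (classic (exists T', In T' LT /\ T' <> T /\ tri_weight T' x <> 0))
    as [(T' & HT' & Hne & Hw0') | Honly].
  - destruct (Hhalf T' HT' Hw0') as (Hw' & mu' & Hmu' & HI').
    assert (Hs := Hopp T T' mu mu' HT HT' (not_eq_sym Hne) Hmu Hmu' HI HI').
    assert (HO : p_interior Oc x).
    { apply p_interior_mono with (2 := p_interior_idem _ _ (p_interior_and _ _ _ HI HI')).
      intros z Hz. apply HOc, p_interior_mono with (2 := Hz).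
      intros w [[H1 _] [H2 _]].
      destruct (Rle_dec 0 (mu * rcross r x w)) as [H | H].
      - exists T. tauto.
      - exists T'. split; [exact HT' |]. apply H2. clear - Hs H. nra. }
    destruct HO as (d & Hd & HO). rewrite (chi_inner Oc x d Hd HO).
    destruct excluded_middle_informative; [lra |].
    rewrite (sum_list_pair _ LT T T' Hnd HT HT' (not_eq_sym Hne)).
    (* The two halves make up the density 1, and the derivative along the bond is the same from both
       sides. *)
    + rewrite Hw, Hw', <- (HDr T HT Hw0), <- (HDr T' HT' Hw0'). field.
    + intros T2 HT2 Hn1 Hn2. destruct (Req_dec (tri_weight T2 x) 0) as [-> | Hw2]; [ring | exfalso].
      destruct (Hhalf T2 HT2 Hw2) as (_ & mu2 & Hmu2 & HI2).
      assert (S1 := Hopp T2 T mu2 mu HT2 HT Hn1 Hmu2 Hmu HI2 HI).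
      assert (S2 := Hopp T2 T' mu2 mu' HT2 HT' Hn2 Hmu2 Hmu' HI2 HI'). lra.
  - assert (Hz : forall T', In T' LT -> T' <> T -> tri_weight T' x = 0).
    { intros T' HT' Hne. apply NNPP. intros H. apply Honly. eauto. }
    assert (HQ : p_interior (fun z => forall T', In T' LT -> T' <> T -> ~ in_tri T' z) x).
    { apply p_interior_list with (S := fun T' z => T' <> T -> ~ in_tri T' z).
      intros T' HT'. destruct (classic (T' = T)) as [E | Hne].
      - exists 1. split; [lra | now intros].
      - apply p_interior_mono with (2 := Hout T' HT' (Hz T' HT' Hne)). auto. }
    assert (Hchi : chi Oc x = 1 / 2).
    { destruct (p_interior_idem _ _ (p_interior_and _ _ _ HI HQ)) as (d & Hd & H).
      apply chi_half_plane with (- (mu * IZR (snd r))) (mu * IZR (fst r)) d; [exact Hd | |].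
      - apply NNPP. intros Hn. assert (Hsq := znonzero_sq r Hr).
        assert (E1 : mu * IZR (fst r) = 0) by (apply NNPP; tauto).
        assert (E2 : - (mu * IZR (snd r)) = 0) by (apply NNPP; tauto).
        apply Rmult_integral in E1. destruct E1 as [E1 | E1]; [contradiction |].
        assert (E3 : mu * IZR (snd r) = 0) by lra.
        apply Rmult_integral in E3. destruct E3 as [E3 | E3]; [contradiction |].
        rewrite E1, E3 in Hsq. lra.
      - intros z Hzd. specialize (H z Hzd).
        replace (- (mu * IZR (snd r)) * (fst z - fst x) + mu * IZR (fst r) * (snd z - snd x))
          with (mu * rcross r x z) by (unfold rcross; ring).
        split.
        (* [Oc] is an interior: a point of it on or beyond the line would have points of the union
           strictly beyond, where neither [T] nor any other triangle reaches. *)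
        + intros HO. apply HOc in HO. apply Rnot_le_lt. intros Hle.
          destruct (half_plane_point r x (- mu) _ z Hr ltac:(lra) (p_interior_and _ _ _ H HO))
            as (w & [[[Hw1 _] Hw2] (T' & HT' & HwT')] & Hp).
          destruct (classic (T' = T)) as [-> | Hne]; [| exact (Hw2 T' HT' Hne HwT')].
          apply Hw1 in HwT'. lra.
        + intros Hp. apply HOc. apply p_interior_self in H as [[_ Hzo] _].
          apply Hzo, (in_tri_open_interior T z (Hdet T HT)) in Hp.
          apply p_interior_mono with (2 := Hp).
          intros w Hwo. exists T. split; [exact HT | now apply in_tri_open_in_tri]. }
    rewrite Hchi. destruct excluded_middle_informative; [lra |].
    rewrite (sum_list_single _ LT T Hnd HT).
    + rewrite Hw, (HDr T HT Hw0). ring.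
    + intros T' HT' Hne. rewrite (Hz T' HT' Hne). ring.
Qed.

(** * Integration along bonds, summation over the lattice, and the theorem *)

(** Each edge line not parallel to the bond excludes a single parameter. *)
Lemma generic_bond (LT : list tri) (i r : zpt) : exists l, forall t, ~ In t l ->
  forall T, In T LT -> generic T r (bond_pt i r t).
Proof.
  set (rt := fun P Q => root (cr_slope P Q r) (cr P Q (inj i))).
  exists (flat_map (fun T => rt (tB T) (tC T) ++ rt (tC T) (tA T) ++ rt (tA T) (tB T)) LT).
  intros t Ht T HT.
  assert (G : forall P Q, ~ In t (rt P Q) -> cr P Q (bond_pt i r t) = 0 -> cr_slope P Q r = 0).
  { intros P Q Hn E. rewrite cr_bond in E. exact (proj1 (affine_off_root _ _ _ Hn E)). }
  split; [| split]; apply G; intros Hin; apply Ht, in_flat_map; exists T;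
    (split; [exact HT |]); rewrite !in_app_iff; tauto.
Qed.

(** The coefficients of the weights do not depend on [i], so the sum over the lattice falls on the
    weights alone, where the bond density lemma applies. *)
Lemma c_b_eq (Oc : pt -> Prop) LT varphi y i r :
  triangulation LT ->
  (forall x, Oc x <-> p_interior (unionT LT) x) ->
  (forall T, In T LT -> affine_on (in_tri T) y) ->
  r <> (0, 0)%Z ->
  c_b Oc varphi y i r =
  sum_list (fun T => phi varphi (Dr y (inj r) (centroid T)) * tri_bond_weight T r i) LT.
Proof.
  intros Htri HOc Haff Hr. apply RInt_unique.
  destruct (generic_bond LT i r) as [l Hl].
  apply is_RInt_ext_off_list with l
    (fun t => sum_list (fun T => phi varphi (Dr y (inj r) (centroid T)) * tri_weight T (bond_pt i r t)) LT);
    [lra | |].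
  - intros t _ Ht. symmetry. apply (bond_integrand Oc LT varphi y r (bond_pt i r t)); auto.
  - apply is_RInt_sum_list. intros T _. apply is_RInt_mult_l, tri_bond_weight_is_RInt.
Qed.

Lemma c_b_away (Oc : pt -> Prop) varphi y i r :
  (forall l, 0 < l < 1 -> ~ p_closure Oc (seg_pt (inj i) (inj (zadd i r)) l)) ->
  c_b Oc varphi y i r = 0.
Proof.
  intros H. apply RInt_unique. apply is_RInt_ext_open with (fun _ => 0); [lra | | apply is_RInt_zero].
  intros l Hl.
  assert (Hd : exists d, 0 < d /\ forall z, p_dist z (seg_pt (inj i) (inj (zadd i r)) l) < d -> ~ Oc z).
  { apply NNPP. intros Hn. apply (H l Hl). intros e He. apply NNPP. intros Hn'.
    apply Hn. exists e. split; [exact He |]. intros z Hz HO. apply Hn'. eauto. }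
  destruct Hd as (d & Hd & HO). rewrite (chi_exterior Oc _ d Hd HO).
  now destruct excluded_middle_informative.
Qed.

Theorem theorem4p3
  (Om Oa : pt -> Prop) (LT : list tri) (LI LR : list zpt)
  (varphi : R -> R) (y : pt -> pt)
  (HOm_open : p_is_open Om) (HOm_bdd : p_bounded Om)
  (HOa_open : p_is_open Oa) (HOa_sub : forall x, Oa x -> Om x)
  (Htri : triangulation LT)
  (HOc_poly : forall x, Oc_of Om Oa x <-> p_interior (unionT LT) x)
  (HOc_cl : forall x, p_closure (Oc_of Om Oa) x <-> unionT LT x)
  (HLI : NoDup LI /\ forall i, In i LI <-> Om (inj i))
  (HLR : NoDup LR /\ ~ In (0%Z, 0%Z) LR)
  (HA2 : forall r i, In r LR ->
     (exists l, 0 < l < 1 /\ p_closure (Oc_of Om Oa) (seg_pt (inj i) (inj (zadd i r)) l)) ->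
     Om (inj i) /\ Om (inj (zadd i r)))
  (Hvarphi : cont_nonneg varphi)
  (Hy : in_P1 LT (p_closure (Oc_of Om Oa)) y) :
  E_ecc (Oc_of Om Oa) LI LR varphi y =
    bond_sum LI LR (fun i r =>
      indic (~ bond_in (Oc_of Om Oa) i r) *
        (e_b varphi y i r - c_b (Oc_of Om Oa) varphi y i r))
    + E_c LT LR varphi y.
Proof.
  set (Oc := Oc_of Om Oa) in *. destruct HLI as [HLI1 HLI2]. destruct HLR as [_ HLR0].
  assert (HEc : E_c LT LR varphi y = bond_sum LI LR (c_b Oc varphi y)).
  { unfold E_c, bond_sum. rewrite sum_list_swap, (sum_list_swap _ LI).
    apply sum_list_ext. intros r Hr. symmetry.
    (* Here (A2) enters, through its contrapositive: a bond outside $\mathcal B$ misses the closure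
       of $\Omega_c$ and contributes 0. The sum over $\mathcal B$ is therefore the sum over the
       lattice. *)
    assert (Hsup : forall i, c_b Oc varphi y i r <> 0 -> In i LI /\ In (zadd i r) LI).
    { intros i Hi. rewrite !HLI2. apply HA2; [exact Hr |]. apply NNPP. intros Hn.
      apply Hi, c_b_away. intros l Hl Hc. apply Hn. eauto. }
    assert (E : forall i, c_b Oc varphi y i r = indic (In (zadd i r) LI) * c_b Oc varphi y i r).
    { intros i. destruct (Req_dec (c_b Oc varphi y i r) 0) as [E | E]; [rewrite E; ring |].
      rewrite indic_true; [ring | now apply Hsup]. }
    apply is_sum_list; [| exact HLI1 | intros i Hi; apply Hsup; intros E0; apply Hi; rewrite E0; ring].
    apply is_sum_ext with (1 := E).
    apply is_sum_ext with (fun i => sum_list (fun T =>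
      phi varphi (Dr y (inj r) (centroid T)) * tri_bond_weight T r i) LT).
    - intros i. symmetry. apply c_b_eq; [exact Htri | exact HOc_poly | apply Hy |].
      intros ->. contradiction.
    - rewrite (sum_list_ext _ (fun T => phi varphi (Dr y (inj r) (centroid T)) * tri_area T))
        by (intros; ring).
      apply is_sum_sum_list. intros T _. apply is_sum_mult_l, bond_density. }
  rewrite HEc. unfold E_ecc, bond_sum. rewrite <- sum_list_add.
  apply sum_list_ext. intros i _. rewrite <- sum_list_add.
  apply sum_list_ext. intros r _.
  (* What remains holds bond by bond: a bond inside $\Omega_c$ gives [c_b] on both sides, and for
     any other bond [c_b] cancels. *)
  destruct (classic (bond_in Oc i r)) as [H | H].
  - rewrite (indic_true (bond_in Oc i r)), (indic_false (~ bond_in Oc i r)) by tauto. ring.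
  - rewrite (indic_false (bond_in Oc i r)), (indic_true (~ bond_in Oc i r)) by tauto. ring.
Qed.
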